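(* Let $n>m$, let $\hat\Sigma_C$ be a real symmetric positive definite $n\times n$ matrix and $\nu\in\mathbb{N}_+=\{1,2,\dots\}$. Then the problem $$\text{minimize } \mathcal{D}_T^{(1-\nu^{-1})}(\hat\Sigma\|\hat\Sigma_C)\ \text{ over }\ \{\hat\Sigma\in\mathcal{Q}_{n,+}: V(\hat\Sigma)=0\}$$ admits a unique solution.
   Context: $\mathcal{Q}_n$ denotes the space of real symmetric $n\times n$ matrices and $\mathcal{Q}_{n,+}$ its cone of positive definite elements. $A\in\mathbb{R}^{n\times n}$ has all eigenvalues in the open unit disk, $B\in\mathbb{R}^{n\times m}$ has full column rank and $(A,B)$ is reachable. $\Pi_B^\perp:=I-B(B^TB)^{-1}B^T$ and $V:\mathcal{Q}_n\to\mathcal{Q}_n$, $V(Q)=\Pi_B^\perp(Q-AQA^T)\Pi_B^\perp$. For $P,Q\in\mathcal{Q}_{n,+}$, let $L_Q$ be the Cholesky factor of $Q$ ($Q=L_QL_Q^T$); for $\tau\in\mathbb{R}\setminus\{0,1\}$, $$\mathcal{D}_T^{(\tau)}(P\|Q):=\operatorname{tr}\Big[\tfrac{1}{\tau(\tau-1)}(L_Q^{-1}PL_Q^{-T})^{\tau}-\tfrac{1}{\tau-1}PQ^{-1}\Big]+\tfrac{n}{\tau}$$ (the additive constant does not affect minimizers), and for $\tau=0$ it is the continuous extension $\mathcal{D}_T^{(0)}(P\|Q)=\operatorname{tr}[\log Q-\log P+PQ^{-1}]-n$ (Burg matrix divergence). Matrix powers and logarithms are via spectral calculus. *)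

(* Defs.v *)
(* real numbers (Reals), matrices as functions nat -> nat -> R
   whose entries are only meaningful on indices below the relevant dimension. *)
From Stdlib Require Import Reals ClassicalEpsilon.
Open Scope R_scope.

Definition Mat := nat -> nat -> R.
Definition Vec := nat -> R.

Fixpoint rsum (k : nat) (f : nat -> R) : R :=
  match k with O => 0 | S k' => rsum k' f + f k' end.

Definition mzero : Mat := fun _ _ => 0.
Definition mid : Mat := fun i j => if Nat.eqb i j then 1 else 0.
Definition mmul (k : nat) (A B : Mat) : Mat := fun i j => rsum k (fun l => A i l * B l j).
Definition mtr (A : Mat) : Mat := fun i j => A j i.
Definition madd (A B : Mat) : Mat := fun i j => A i j + B i j.
Definition msub (A B : Mat) : Mat := fun i j => A i j - B i j.
Definition mscale (c : R) (A : Mat) : Mat := fun i j => c * A i j.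
Definition mvec (k : nat) (A : Mat) (x : Vec) : Vec := fun i => rsum k (fun j => A i j * x j).
Definition trace (n : nat) (A : Mat) : R := rsum n (fun i => A i i).
Definition mdiag (d : Vec) : Mat := fun i j => if Nat.eqb i j then d i else 0.
Fixpoint mpow (n : nat) (A : Mat) (k : nat) : Mat :=
  match k with O => mid | S k' => mmul n A (mpow n A k') end.

Definition meq (p q : nat) (A B : Mat) : Prop :=
  forall i j, (i < p)%nat -> (j < q)%nat -> A i j = B i j.

Definition vnonzero (k : nat) (x : Vec) : Prop := exists i, (i < k)%nat /\ x i <> 0.

Definition symmetric (n : nat) (A : Mat) : Prop := meq n n A (mtr A).

Definition posdef (n : nat) (A : Mat) : Prop :=
  symmetric n A /\
  forall x : Vec, vnonzero n x -> 0 < rsum n (fun i => x i * mvec n A x i).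

Definition is_inv (n : nat) (A B : Mat) : Prop :=
  meq n n (mmul n A B) mid /\ meq n n (mmul n B A) mid.
Definition minv (n : nat) (A : Mat) : Mat := epsilon (inhabits mzero) (is_inv n A).

Definition is_cholesky (n : nat) (Q L : Mat) : Prop :=
  (forall i j, (i < j)%nat -> (j < n)%nat -> L i j = 0) /\
  (forall i, (i < n)%nat -> 0 < L i i) /\
  meq n n (mmul n L (mtr L)) Q.
Definition chol (n : nat) (Q : Mat) : Mat := epsilon (inhabits mzero) (is_cholesky n Q).

Definition is_eigdec (n : nat) (M : Mat) (p : Mat * Vec) : Prop :=
  meq n n (mmul n (mtr (fst p)) (fst p)) mid /\
  meq n n M (mmul n (mmul n (fst p) (mdiag (snd p))) (mtr (fst p))).
Definition matfun (n : nat) (f : R -> R) (M : Mat) : Mat :=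
  let p := epsilon (inhabits (mzero, fun _ : nat => 0)) (is_eigdec n M) in
  mmul n (mmul n (fst p) (mdiag (fun i => f (snd p i)))) (mtr (fst p)).

(* D_T^{(tau)}(P || Q); tau = 0 is the Burg matrix divergence *)
Definition DT (n : nat) (tau : R) (P Q : Mat) : R :=
  if Req_EM_T tau 0 then
    trace n (madd (msub (matfun n ln Q) (matfun n ln P)) (mmul n P (minv n Q))) - INR n
  else
    let Li := minv n (chol n Q) in
    trace n (msub (mscale (/ (tau * (tau - 1)))
                     (matfun n (fun x => Rpower x tau) (mmul n (mmul n Li P) (mtr Li))))
                  (mscale (/ (tau - 1)) (mmul n P (minv n Q))))
    + INR n / tau.

Definition PiBperp (n m : nat) (B : Mat) : Mat :=
  msub mid (mmul m (mmul m B (minv m (mmul n (mtr B) B))) (mtr B)).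

Definition Vop (n m : nat) (A B Q : Mat) : Mat :=
  let Pi := PiBperp n m B in
  mmul n (mmul n Pi (msub Q (mmul n (mmul n A Q) (mtr A)))) Pi.

(* every (complex) eigenvalue a + i b of A lies in the open unit disk;
   a complex eigenvector x + i y is written through its real and imaginary parts *)
Definition schur_stable (n : nat) (A : Mat) : Prop :=
  forall (a b : R) (x y : Vec),
    (vnonzero n x \/ vnonzero n y) ->
    (forall i, (i < n)%nat -> mvec n A x i = a * x i - b * y i) ->
    (forall i, (i < n)%nat -> mvec n A y i = b * x i + a * y i) ->
    a * a + b * b < 1.

Definition full_col_rank (n m : nat) (B : Mat) : Prop :=
  forall z : Vec, vnonzero m z -> vnonzero n (mvec m B z).

(* (A,B) reachable: [B AB ... A^{n-1}B] has rank n, i.e. no nonzero w with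
   w^T A^k B = 0 for all k < n *)
Definition reachable (n m : nat) (A B : Mat) : Prop :=
  forall w : Vec, vnonzero n w ->
    exists k j, (k < n)%nat /\ (j < m)%nat /\
      rsum n (fun i => w i * mmul n (mpow n A k) B i j) <> 0.

(* Main.v *)
(* Whitening S to X = L^-1 S L^-T, with L the Cholesky factor of SigC, turns the
   divergence into sum_i phi(lambda_i(X)) up to a constant, where phi is strictly
   convex on ]0, +oo[ with phi' = psi, psi x = (1 - x^(tau - 1)) / (1 - tau).
   Klein's inequality
     sum phi(Y) >= sum phi(X) + tr psi(X) (Y - X),   strict unless X = Y,
   gives uniqueness at once (apply it at the midpoint of two minimizers), and it
   presents the objective as a supremum of affine functions, so no continuity of
   the spectral calculus is needed for existence: a minimizing sequence is bounded
   since phi is coercive, and a cluster point M is a minimizer as soon as it is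
   positive definite.  If M were singular, Klein's inequality at
   (1 - t) M + t X0, with X0 feasible, would bound psi at the least eigenvalue
   from below as t tends to 0, whereas psi tends to -oo at 0.
   A feasible X0 comes from the Lyapunov equation Q - A Q A^T = B B^T: since
   A^k tends to 0 it is uniquely solvable, and telescoping with reachability makes
   Q positive definite. *)
Require Import Defs.
From Stdlib Require Import Reals Lra ClassicalEpsilon.
Open Scope R_scope.

(** * The scalar function *)

(** Contribution of one eigenvalue x of the whitened matrix to the divergence; the additive
    constants are kept apart in [DT_shift]. *)
Definition divergence_fun (tau x : R) : R :=
  if Req_EM_T tau 0 then x - ln x
  else / (tau * (tau - 1)) * Rpower x tau - / (tau - 1) * x.

(** A single formula covers both cases: at tau = 0 it is 1 - 1/x. *)
Definition divergence_deriv (tau x : R) : R :=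
  (1 - Rpower x (tau - 1)) / (1 - tau).

Lemma divergence_fun_derivable (tau x : R) : 0 <= tau < 1 -> 0 < x ->
  derivable_pt_lim (divergence_fun tau) x (divergence_deriv tau x).
Proof.
intros Ht Hx; unfold divergence_fun, divergence_deriv.
destruct (Req_EM_T tau 0) as [->|Ht0].
- replace ((1 - Rpower x (0 - 1)) / (1 - 0)) with (1 - / x).
  + apply derivable_pt_lim_minus; [apply derivable_pt_lim_id|].
    now apply derivable_pt_lim_ln.
  + replace (0 - 1) with (- (1)) by ring.
    rewrite Rpower_Ropp, Rpower_1 by assumption; field; lra.
- replace ((1 - Rpower x (tau - 1)) / (1 - tau)) with
    (/ (tau * (tau - 1)) * (tau * Rpower x (tau - 1)) - / (tau - 1) * 1)
    by (field; lra).
  apply (derivable_pt_lim_minus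
    (fun x => / (tau * (tau - 1)) * Rpower x tau) (fun x => / (tau - 1) * x)).
  + apply (derivable_pt_lim_scal (fun x => Rpower x tau)).
    now apply derivable_pt_lim_power.
  + apply (derivable_pt_lim_scal (fun x => x)), derivable_pt_lim_id.
Qed.

Lemma divergence_deriv_increasing (tau a b : R) : 0 <= tau < 1 -> 0 < a -> a < b ->
  divergence_deriv tau a < divergence_deriv tau b.
Proof.
intros Ht Ha Hab; unfold divergence_deriv, Rdiv.
apply Rmult_lt_compat_r; [apply Rinv_0_lt_compat; lra|].
enough (Rpower b (tau - 1) < Rpower a (tau - 1)) by lra.
unfold Rpower; apply exp_increasing.
assert (ln a < ln b) by now apply ln_increasing.
nra.
Qed.

(** By the mean value theorem the chord has the slope of the derivative at a point strictly between
    a and b, and the derivative is strictly increasing. *)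
Lemma divergence_fun_tangent (tau a b : R) : 0 <= tau < 1 -> 0 < a -> 0 < b -> a <> b ->
  divergence_fun tau a + divergence_deriv tau a * (b - a) < divergence_fun tau b.
Proof.
intros Ht Ha Hb Hab; destruct (Rlt_or_le a b) as [H|H].
- destruct (MVT_cor2 (divergence_fun tau) (divergence_deriv tau) a b H)
    as [c [Hc Hacb]].
  { intros c Hc; apply divergence_fun_derivable; lra. }
  assert (divergence_deriv tau a < divergence_deriv tau c)
    by (apply divergence_deriv_increasing; lra).
  nra.
- assert (H' : b < a) by lra.
  destruct (MVT_cor2 (divergence_fun tau) (divergence_deriv tau) b a H')
    as [c [Hc Hacb]].
  { intros c Hc; apply divergence_fun_derivable; lra. }
  assert (divergence_deriv tau c < divergence_deriv tau a)
    by (apply divergence_deriv_increasing; lra).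
  nra.
Qed.

(** Provides a tangent of positive slope, the source of coercivity; 2 stands for any point beyond
    the zero 1 of the derivative. *)
Lemma divergence_deriv_2 (tau : R) : 0 <= tau < 1 -> 0 < divergence_deriv tau 2.
Proof.
intros Ht.
replace 0 with (divergence_deriv tau 1).
- apply divergence_deriv_increasing; lra.
- unfold divergence_deriv, Rpower; rewrite ln_1, Rmult_0_r, exp_0; field; lra.
Qed.

Lemma divergence_deriv_ub (tau a : R) : 0 <= tau < 1 ->
  divergence_deriv tau a <= / (1 - tau).
Proof.
intros Ht; unfold divergence_deriv, Rdiv.
rewrite <- (Rmult_1_l (/ (1 - tau))) at 2.
apply Rmult_le_compat_r; [left; apply Rinv_0_lt_compat; lra|].
unfold Rpower; pose proof (exp_pos ((tau - 1) * ln a)); lra.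
Qed.

(** The product is (a - a^tau) / (1 - tau). For a < 1 it is controlled by a^tau <= 1; for a >= 1 it
    is non-negative. In the minimization it tames the pole of the derivative at 0. *)
Lemma divergence_deriv_mul_lb (tau a : R) : 0 <= tau < 1 -> 0 < a ->
  - / (1 - tau) <= divergence_deriv tau a * a.
Proof.
intros Ht Ha; unfold divergence_deriv, Rdiv.
assert (Hi : 0 < / (1 - tau)) by (apply Rinv_0_lt_compat; lra).
enough (-1 <= (1 - Rpower a (tau - 1)) * a) by nra.
destruct (Rlt_or_le a 1) as [H|H].
- assert (E : Rpower a (tau - 1) * a = Rpower a tau).
  { rewrite <- (Rpower_1 a Ha) at 2; rewrite <- Rpower_plus; f_equal; ring. }
  enough (Rpower a tau <= 1) by nra.
  unfold Rpower; apply Rle_trans with (exp 0); [|rewrite exp_0; lra].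
  assert (ln a < 0) by (rewrite <- ln_1; now apply ln_increasing).
  destruct (Req_dec (tau * ln a) 0) as [->|]; [right; reflexivity|].
  left; apply exp_increasing; nra.
- enough (Rpower a (tau - 1) <= 1) by nra.
  unfold Rpower; apply Rle_trans with (exp 0); [|rewrite exp_0; lra].
  destruct (Rle_lt_or_eq_dec 1 a H) as [H1|<-].
  + left; apply exp_increasing.
    assert (0 < ln a) by (rewrite <- ln_1; apply ln_increasing; lra).
    nra.
  + rewrite ln_1, Rmult_0_r; right; reflexivity.
Qed.

Lemma divergence_deriv_ninfty (tau M : R) : 0 <= tau < 1 ->
  exists e, 0 < e /\ forall a, 0 < a -> a <= e -> divergence_deriv tau a < M.
Proof.
(* With this s, (1 - s) / (1 - tau) = - |M|; the threshold below makes (tau - 1) ln a >= s, and exp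
   y > 1 + y concludes. *)
intros Ht; set (s := 1 + Rabs M * (1 - tau)).
exists (exp (- (s / (1 - tau)))); split; [apply exp_pos|].
intros a Ha Hae; unfold divergence_deriv.
assert (Hs : 1 <= s).
{ unfold s; pose proof (Rabs_pos M); nra. }
assert (Hln : ln a <= - (s / (1 - tau))).
{ rewrite <- (ln_exp (- (s / (1 - tau)))).
  destruct Hae as [Hae| ->]; [left; now apply ln_increasing|lra]. }
assert (Hsm : s <= (tau - 1) * ln a).
{ replace s with ((1 - tau) * (s / (1 - tau))) at 1 by (field; lra); nra. }
assert (Hexp : s < Rpower a (tau - 1)).
{ unfold Rpower; pose proof (exp_ineq1 ((tau - 1) * ln a)); lra. }
apply (Rmult_lt_reg_r (1 - tau)); [lra|].
replace ((1 - Rpower a (tau - 1)) / (1 - tau) * (1 - tau)) with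
  (1 - Rpower a (tau - 1)) by (field; lra).
assert (- Rabs M <= M) by (unfold Rabs; destruct (Rcase_abs M); lra).
unfold s in Hexp; nra.
Qed.

(* In a module, since the ssrnat and ring_scope notations would change the meaning
   of the statement of theorem2. *)
Module SpectralDivergence.
From HB Require Import structures.
From mathcomp Require Import all_boot all_order all_algebra.
From mathcomp Require Import boolp classical_sets reals topology normedtype sequences.
From mathcomp Require Import complex Rstruct.
From mathcomp Require Import ring lra.
Set Implicit Arguments.
Unset Strict Implicit.
Unset Printing Implicit Defensive.
Import Order.TTheory GRing.Theory Num.Theory.
Import numFieldNormedType.Exports.
Local Open Scope ring_scope.

(** * Quadratic forms and the spectral theorem *)

Definition qf (R : pzRingType) n (X : 'M[R]_n) (x : 'cV[R]_n) : R :=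
  (x^T *m X *m x) 0 0.

Definition possemidefmx (R : numDomainType) n (X : 'M[R]_n) :=
  X^T = X /\ forall x, 0 <= qf X x.

Definition posdefmx (R : numDomainType) n (X : 'M[R]_n) :=
  X^T = X /\ forall x, x != 0 -> 0 < qf X x.

Definition eigdecmx (R : pzRingType) n (X U : 'M[R]_n) (d : 'rV[R]_n) :=
  U^T *m U = 1%:M /\ X = U *m diag_mx d *m U^T.

Section QuadraticForm.
Variables (R : realFieldType) (n : nat).
Implicit Types (X Y : 'M[R]_n) (x : 'cV[R]_n).

Lemma qfD X Y x : qf (X + Y) x = qf X x + qf Y x.
Proof. by rewrite /qf mulmxDr mulmxDl mxE. Qed.

Lemma qfZ a X x : qf (a *: X) x = a * qf X x.
Proof. by rewrite /qf -scalemxAr -scalemxAl mxE. Qed.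

Lemma qf0 X : qf X 0 = 0.
Proof. by rewrite /qf mulmx0 mxE. Qed.

Lemma qf_congr (m : nat) (L : 'M[R]_(n, m)) X (x : 'cV[R]_m) :
  qf (L^T *m X *m L) x = qf X (L *m x).
Proof. by rewrite /qf trmx_mul !mulmxA. Qed.

Lemma qf1 x : qf 1%:M x = \sum_i x i 0 ^+ 2.
Proof. by rewrite /qf mulmx1 mxE; apply: eq_bigr => i _; rewrite mxE. Qed.

Lemma qf1_ge0 x : 0 <= qf 1%:M x.
Proof. by rewrite qf1 sumr_ge0 // => i _; rewrite sqr_ge0. Qed.

Lemma qf1_eq0 x : (qf 1%:M x == 0) = (x == 0).
Proof.
rewrite qf1 psumr_eq0; last by move=> i _; rewrite sqr_ge0.
apply/allP/eqP => [h|-> i _]; last by rewrite mxE expr0n eqxx.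
apply/colP => i; rewrite mxE.
by have := h i (mem_index_enum _); rewrite sqrf_eq0 => /eqP.
Qed.

Lemma qf1_gt0 x : x != 0 -> 0 < qf 1%:M x.
Proof. by move=> x0; rewrite lt_def qf1_ge0 qf1_eq0 x0. Qed.

Lemma posdef_semidef X : posdefmx X -> possemidefmx X.
Proof.
move=> [sX pX]; split => // x; have [->|x0] := eqVneq x 0; first by rewrite qf0.
exact/ltW/pX.
Qed.

End QuadraticForm.

Section RealEigen.
Variable R : rcfType.

(* A complex eigenvalue a + ib makes (X - a)^2 + b^2 singular, and for symmetric
   X this forces X - a to be singular. *)
Lemma symmetric_eigenvector n (X : 'M[R]_n) : (0 < n)%N -> X^T = X ->
  exists a (u : 'cV[R]_n), u != 0 /\ X *m u = a *: u.
Proof.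
move=> n0 sX.
have [l] := @eigenvalue_closed R[i] n (map_mx (real_complex R) X) n0.
case: l => a b /eigenvalueP [v vX v0].
pose Z := (X - a%:M) *m (X - a%:M) + (b ^+ 2)%:M.
have detZ : \det Z = 0.
  apply: (@complexI R); rewrite -det_map_mx rmorph0.
  apply/eqP/det0P; exists v => //.
  rewrite /Z map_mxD map_mxM map_mxB !map_scalar_mx mulmxDr mulmxA /=.
  rewrite [v *m (_ - _)]mulmxBr vX mul_mx_scalar -scalerBl -scalemxAl.
  rewrite mulmxBr vX mul_mx_scalar.
  rewrite -scalerBl mul_mx_scalar scalerA -scalerDl.
  suff -> : ((a +i* b)%C - a%:C%C) * ((a +i* b)%C - a%:C%C) + (b ^+ 2)%:C%C = 0 :> R[i].
    by rewrite scale0r.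
  by apply/eqP; rewrite eq_complex /=; apply/andP; split; apply/eqP; ring.
have [w w0 wZ] : exists2 w : 'rV[R]_n, w != 0 & w *m Z = 0.
  by apply/det0P/eqP.
have trXa : (X - a%:M)^T = X - a%:M by rewrite linearB /= sX tr_scalar_mx.
(* Since X - a is symmetric, w Z w^T is a sum of two non-negative terms, so the first one
   vanishes. *)
have : qf 1%:M ((X - a%:M) *m w^T) + b ^+ 2 * qf 1%:M w^T = 0.
  have : (w *m Z *m w^T) 0 0 = 0 by rewrite wZ mul0mx mxE.
  rewrite /Z mulmxDr mulmxDl mxE mul_mx_scalar -scalemxAl [X in _ + X]mxE => <-.
  by rewrite /qf trmx_mul trXa trmxK !mulmx1 !mulmxA.
move=> h.
have q0 : qf 1%:M ((X - a%:M) *m w^T) = 0.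
  apply/eqP; rewrite eq_le qf1_ge0 andbT -h lerDl.
  by rewrite mulr_ge0 ?sqr_ge0 ?qf1_ge0.
exists a, w^T; split; first by rewrite trmx_eq0.
move/eqP: q0; rewrite qf1_eq0 mulmxBl mul_scalar_mx subr_eq0.
by move/eqP.
Qed.

Lemma symmetric_unit_eigenvector n (X : 'M[R]_n) : (0 < n)%N -> X^T = X ->
  exists a (u : 'cV[R]_n), u^T *m u = 1%:M /\ X *m u = a *: u.
Proof.
move=> n0 /(symmetric_eigenvector n0) [a [u [u0 ua]]].
have q0 : 0 < Num.sqrt (qf 1%:M u) by rewrite sqrtr_gt0 qf1_gt0.
exists a, ((Num.sqrt (qf 1%:M u))^-1 *: u); split; last first.
  by rewrite -scalemxAr ua !scalerA mulrC.
rewrite [(_ *: _)^T]linearZ /= -scalemxAl -scalemxAr scalerA -expr2.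
rewrite [u^T *m u]mx11_scalar.
have -> : (u^T *m u) 0 0 = qf 1%:M u by rewrite /qf mulmx1.
rewrite exprVn sqr_sqrtr ?qf1_ge0 //.
by rewrite scale_scalar_mx mulVf // gt_eqF // qf1_gt0.
Qed.

(* Householder reflection along u - e. *)
Lemma orthogonal_symmetric_map n (u e : 'cV[R]_n) :
  u^T *m u = 1%:M -> e^T *m e = 1%:M ->
  exists H : 'M[R]_n, [/\ H^T = H, H *m H = 1%:M, H *m e = u & H *m u = e].
Proof.
move=> u1 e1; have [<-|neq] := eqVneq e u.
  by exists 1%:M; rewrite trmx1 !mul1mx.
pose w := u - e; pose q := qf 1%:M w.
have q0 : 0 < q by apply: qf1_gt0; rewrite subr_eq0 eq_sym.
have ww : w^T *m w = q%:M by rewrite [LHS]mx11_scalar /q /qf mulmx1.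
have ue : u^T *m e = e^T *m u.
  apply/matrixP => i j; rewrite !ord1 !mxE; apply: eq_bigr => k _.
  by rewrite !mxE mulrC.
have wT : w^T = u^T - e^T by rewrite /w linearB.
(* For unit vectors |u - e|^2 = 2 - 2 u.e, so w.e = u.e - 1 = - q / 2, and the reflection sends e to
   e + w = u. *)
have we : w^T *m e = (- (q / 2))%:M.
  have : w^T *m w = (1 + 1)%:M - (u^T *m e) *+ 2.
    rewrite wT mulmxBl !mulmxBr u1 e1 -ue mulr2n.
    move: (u^T *m e) => z; apply/matrixP => i j.
    by rewrite !mxE !ord1 eqxx /= !mulr1n; ring.
  have -> : w^T *m e = u^T *m e - 1%:M by rewrite wT mulmxBl e1.
  rewrite ww [u^T *m e]mx11_scalar; set c := _ 0 0.
  rewrite -raddfMn -raddfB => /matrixP /(_ 0 0); rewrite !mxE /= !mulr1n => ->.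
  by rewrite -raddfB /=; congr (_%:M); field.
pose H := 1%:M - (2 / q) *: (w *m w^T).
have HT : H^T = H by rewrite /H linearB /= trmx1 linearZ /= trmx_mul trmxK.
have HH : H *m H = 1%:M.
  rewrite /H mulmxBl mul1mx mulmxBr mulmx1 -scalemxAl -scalemxAr.
  rewrite mulmxA -(mulmxA w) ww mul_mx_scalar -scalemxAl !scalerA.
  rewrite -[X in _ - X]scalerBl -addrA -opprD -scalerDl.
  rewrite (_ : 2 / q + _ = 0) ?scale0r ?subr0 //.
  by field; rewrite gt_eqF.
have He : H *m e = u.
  rewrite /H mulmxBl mul1mx -scalemxAl -mulmxA we mul_mx_scalar scalerA.
  rewrite -scaleNr (_ : - _ = 1); last by field; rewrite gt_eqF.
  by rewrite scale1r /w addrC subrK.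
by exists H; split => //; rewrite -He mulmxA HH mul1mx.
Qed.

(** Induction on the dimension. A reflection H exchanging a unit eigenvector and the first basis
    vector e makes e an eigenvector of H X H; by symmetry this matrix is block diagonal, and the
    induction hypothesis treats the lower right block. *)
Theorem symmetric_eigdec n (X : 'M[R]_n) : X^T = X -> exists U d, eigdecmx X U d.
Proof.
elim: n X => [|n IH] X sX.
  by exists 1%:M, 0; split; apply/matrixP => -[].
have [a [u [u1 Xu]]] := symmetric_unit_eigenvector (ltn0Sn n) sX.
pose e : 'cV[R]_(1 + n) := col_mx 1%:M 0.
have e1 : e^T *m e = 1%:M.
  by rewrite tr_col_mx mul_row_col trmx1 mulmx1 trmx0 mul0mx addr0.
have [H [HT HH He Hu]] := @orthogonal_symmetric_map (1 + n) u e u1 e1.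
pose Y : 'M[R]_(1 + n) := H *m X *m H.
have sY : Y^T = Y by rewrite /Y !trmx_mul HT sX mulmxA.
have Ye : Y *m e = a *: e.
  by rewrite /Y -!mulmxA He Xu -scalemxAr Hu.
have YE : Y = block_mx a%:M 0 0 (drsubmx Y).
  have := Ye; rewrite -{1}(submxK Y) mul_block_col !mulmx1 !mulmx0 !addr0.
  rewrite scale_col_mx scaler0 scalemx1 => /eq_col_mx [ul dl].
  have ur : ursubmx Y = 0.
    by rewrite -[Y]sY -[Y in Y^T]submxK tr_block_mx block_mxKur dl trmx0.
  by rewrite -{1}(submxK Y) ul dl ur.
have [U [d [Uo Yd]]] : exists U d, eigdecmx (drsubmx Y) U d.
  by apply: IH; rewrite trmx_drsub sY.
pose K : 'M[R]_(1 + n) := block_mx 1%:M 0 0 U.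
have KK : K^T *m K = 1%:M.
  rewrite /K tr_block_mx mulmx_block !trmx0 !mul0mx !mulmx0 !addr0 add0r.
  by rewrite trmx1 mulmx1 Uo -scalar_mx_block.
exists (H *m K), (row_mx a%:M d); split.
  by rewrite trmx_mul HT mulmxA -(mulmxA K^T H H) HH mulmx1.
have YK : K *m diag_mx (row_mx a%:M d) *m K^T = Y.
  rewrite YE Yd diag_mx_row /K tr_block_mx !mulmx_block !trmx0 trmx1.
  rewrite !mul0mx !mulmx0 !mulmx1 !mul1mx ?mul0mx ?mulmx0 !addr0 !add0r.
  rewrite mul0mx; congr (block_mx _ _ _ _).
  by apply/matrixP => i j; rewrite !mxE !ord1 /= mulr1n.
transitivity (H *m Y *m H).
  by rewrite /Y !mulmxA HH mul1mx -mulmxA HH mulmx1.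
by rewrite -YK trmx_mul HT !mulmxA.
Qed.

End RealEigen.

(** * Klein's inequality *)

Lemma mulmx_col (R : pzRingType) m n p (A : 'M[R]_(m, n)) (B : 'M_(n, p)) i :
  A *m col i B = col i (A *m B).
Proof. by rewrite !colE mulmxA. Qed.

Lemma mulmx_colE (R : pzRingType) m n p (A : 'M[R]_(m, n)) (B : 'M_(n, p)) i j :
  (A *m col i B) j 0 = (A *m B) j i.
Proof. by rewrite mulmx_col mxE. Qed.

Lemma qf_col (R : pzRingType) m n (X : 'M[R]_n) (U : 'M[R]_(n, m)) i :
  qf X (col i U) = (U^T *m X *m U) i i.
Proof. by rewrite /qf tr_col -row_mul mulmx_colE -row_mul mxE. Qed.

Section EigenDecomposition.
Variables (R : rcfType) (n : nat) (X U : 'M[R]_n) (d : 'rV[R]_n).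
Hypothesis XUd : eigdecmx X U d.

Lemma eigdec_mulmxV : U *m U^T = 1%:M.
Proof. by case: XUd => /mulmx1C. Qed.

Lemma eigdec_qf x : qf X x = \sum_i d 0 i * (U^T *m x) i 0 ^+ 2.
Proof.
case: XUd => _ ->.
have -> : U *m diag_mx d *m U^T = U^T^T *m diag_mx d *m U^T by rewrite trmxK.
rewrite qf_congr /qf mul_mx_diag !mxE.
by apply: eq_bigr => i _; rewrite !mxE; ring.
Qed.

Lemma eigdec_qf1 x : qf 1%:M x = \sum_i (U^T *m x) i 0 ^+ 2.
Proof.
by rewrite -qf1 -(qf_congr U^T) trmxK mulmx1 eigdec_mulmxV.
Qed.

Lemma eigdec_tr_col i : U^T *m col i U = delta_mx i 0.
Proof.
case: XUd => UU _; apply/colP => j.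
by rewrite mulmx_col UU !mxE eqxx andbT.
Qed.

Lemma eigdec_qf_col i : qf X (col i U) = d 0 i.
Proof.
rewrite eigdec_qf eigdec_tr_col (bigD1 i) //= big1 ?addr0 => [|j ji].
  by rewrite !mxE !eqxx expr1n mulr1.
by rewrite !mxE (negPf ji) expr0n mulr0.
Qed.

Lemma eigdec_qf1_col i : qf 1%:M (col i U) = 1.
Proof.
rewrite eigdec_qf1 eigdec_tr_col (bigD1 i) //= big1 ?addr0 => [|j ji].
  by rewrite !mxE !eqxx expr1n.
by rewrite !mxE (negPf ji) expr0n.
Qed.

Lemma eigdec_col_neq0 i : col i U != 0.
Proof. by rewrite -qf1_eq0 eigdec_qf1_col oner_eq0. Qed.

Lemma eigdec_gt0 i : posdefmx X -> 0 < d 0 i.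
Proof. by move=> [_ pX]; rewrite -eigdec_qf_col pX ?eigdec_col_neq0. Qed.

Lemma eigdec_mxtrace : \tr X = \sum_i d 0 i.
Proof.
by case: XUd => UU ->; rewrite mxtrace_mulC mulmxA UU mul1mx mxtrace_diag.
Qed.

Lemma eigdec_det : \det X = \prod_i d 0 i.
Proof.
case: XUd => UU ->; rewrite !det_mulmx mulrAC -[X in X * _]det_mulmx.
by rewrite eigdec_mulmxV det1 mul1r det_diag.
Qed.

Lemma eigdec_qf_lower (c : R) x : (forall i, c <= d 0 i) ->
  c * qf 1%:M x <= qf X x.
Proof.
move=> cd; rewrite eigdec_qf eigdec_qf1 mulr_sumr ler_sum // => i _.
by rewrite ler_wpM2r ?sqr_ge0.
Qed.

End EigenDecomposition.

Lemma posdef_lower_bound (R : rcfType) n (X : 'M[R]_n) : posdefmx X ->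
  exists2 c, 0 < c & forall x, c * qf 1%:M x <= qf X x.
Proof.
move=> pX; have [U [d XUd]] := symmetric_eigdec (proj1 pX).
(* The least eigenvalue, capped by 1 so that it stays positive in dimension 0 too. *)
exists (\big[Num.min/1]_i d 0 i).
  elim/big_ind: _ => // [x y x0 y0|i _]; first by rewrite lt_min x0.
  exact: (eigdec_gt0 XUd).
by move=> x; apply: (@eigdec_qf_lower _ _ _ _ _ XUd _ x) => i; exact: bigmin_le_cond.
Qed.

Section Klein.
Variables (R : rcfType) (phi psi : R -> R).
Hypothesis tangent_lt : forall a b : R, 0 < a -> 0 < b -> a != b ->
  phi a + psi a * (b - a) < phi b.
Variables (n : nat) (X U Y V : 'M[R]_n) (a b : 'rV[R]_n).
Hypotheses (XUa : eigdecmx X U a) (YVb : eigdecmx Y V b).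
Hypotheses (pX : posdefmx X) (pY : posdefmx Y).

Let W := V^T *m U.
Let gap i j := phi (b 0 j) - phi (a 0 i) - psi (a 0 i) * (b 0 j - a 0 i).

Let gap_ge0 i j : 0 <= gap i j.
Proof.
rewrite /gap; have [->|ab] := eqVneq (a 0 i) (b 0 j).
  by rewrite !subrr mulr0 subrr.
by have := tangent_lt (eigdec_gt0 XUa i pX) (eigdec_gt0 YVb j pY) ab; lra.
Qed.

(** The squares of the entries of the orthogonal matrix W = V^T U form a doubly stochastic matrix,
    so every sum can be spread over pairs (i, j), and the matrix inequality reduces to the scalar
    tangent inequality for each pair. *)
Lemma klein_gap : \sum_j phi (b 0 j) - \sum_i phi (a 0 i)
    - \sum_i psi (a 0 i) * (qf Y (col i U) - a 0 i) =
  \sum_i \sum_j W j i ^+ 2 * gap i j.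
Proof.
have Wi i : \sum_j W j i ^+ 2 = 1.
  rewrite -(eigdec_qf1_col XUa i) (eigdec_qf1 YVb).
  by apply: eq_bigr => j _; rewrite mulmx_colE.
have Wj j : \sum_i W j i ^+ 2 = 1.
  rewrite -(eigdec_qf1_col YVb j) (eigdec_qf1 XUa).
  apply: eq_bigr => i _.
  by rewrite mulmx_colE -[U^T *m V]trmxK trmx_mul trmxK [_^T i j]mxE.
have Yi i : qf Y (col i U) = \sum_j b 0 j * W j i ^+ 2.
  by rewrite (eigdec_qf YVb); apply: eq_bigr => j _; rewrite mulmx_colE.
have -> : \sum_j phi (b 0 j) = \sum_i \sum_j W j i ^+ 2 * phi (b 0 j).
  by rewrite exchange_big /=; apply: eq_bigr => j _; rewrite -mulr_suml Wj mul1r.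
rewrite -!sumrB; apply: eq_bigr => i _.
rewrite Yi -[X in _ - X - _](mul1r) -[X in _ * (_ - X)](mul1r) -(Wi i).
rewrite !mulr_suml -!sumrB mulr_sumr -!sumrB; apply: eq_bigr => j _.
by rewrite /gap; ring.
Qed.

Lemma klein_le : \sum_i phi (a 0 i)
    + \sum_i psi (a 0 i) * (qf Y (col i U) - a 0 i) <= \sum_j phi (b 0 j).
Proof.
rewrite -subr_ge0 opprD addrA klein_gap.
by do 2!(apply: sumr_ge0 => ? _); rewrite mulr_ge0 ?sqr_ge0.
Qed.

(** In case of equality every weighted gap vanishes, so W j i = 0 unless a_i = b_j. Then W
    intertwines the two diagonal matrices, which means X = Y. *)
Lemma klein_lt : X != Y -> \sum_i phi (a 0 i)
    + \sum_i psi (a 0 i) * (qf Y (col i U) - a 0 i) < \sum_j phi (b 0 j).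
Proof.
move=> XY; rewrite lt_def klein_le andbT -subr_eq0 opprD addrA klein_gap.
apply: contra XY => /eqP s0; apply/eqP.
have Wab i j : W j i * a 0 i = W j i * b 0 j.
  have [->|ab] := eqVneq (a 0 i) (b 0 j) => //.
  have gt : gap i j != 0.
    rewrite /gap.
    by have := tangent_lt (eigdec_gt0 XUa i pX) (eigdec_gt0 YVb j pY) ab; lra.
  have t0 k l : 0 <= W l k ^+ 2 * gap k l by rewrite mulr_ge0 ?sqr_ge0.
  have s1 : \sum_l W l i ^+ 2 * gap i l = 0.
    by apply: (psumr_eq0P _ s0) => // k _; apply: sumr_ge0.
  have /eqP : W j i ^+ 2 * gap i j = 0 by apply: (psumr_eq0P _ s1).
  by rewrite mulf_eq0 (negPf gt) orbF sqrf_eq0 => /eqP ->; rewrite !mul0r.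
have WW : W *m diag_mx a = diag_mx b *m W.
  rewrite mul_mx_diag mul_diag_mx; apply/matrixP => j i.
  by rewrite [LHS]mxE [RHS]mxE Wab mulrC.
have VV := eigdec_mulmxV YVb.
have UE : U = V *m W by rewrite /W mulmxA VV mul1mx.
case: XUa YVb => UU XE [_ YE].
have UW : W *m U^T = V^T by rewrite /W -mulmxA (eigdec_mulmxV XUa) mulmx1.
transitivity (V *m (W *m diag_mx a) *m U^T); first by rewrite mulmxA -UE.
by rewrite WW YE -(mulmxA V) -(mulmxA _ W) UW mulmxA.
Qed.

End Klein.

(** * Cluster points *)

Definition cluster_mx (R : realType) m n (X : nat -> 'M[R]_(m, n)) (M : 'M[R]_(m, n)) :=
  forall e : R, 0 < e -> forall N : nat, exists2 k, (N <= k)%N &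
    forall i j, `|X k i j - M i j| < e.

Section Cluster.
Local Open Scope classical_set_scope.
Local Open Scope ring_scope.
Variable R : realType.

(** Flattened to row vectors, the matrices stay in a product of segments, which is compact. *)
Lemma bounded_cluster_mx m n (X : nat -> 'M[R]_(m, n)) (T : R) :
  (forall k i j, `|X k i j| <= T) -> exists M, cluster_mx X M.
Proof.
move=> bX; pose Y k : 'rV[R]_(m * n) := mxvec (X k).
have K : compact [set v : 'rV[R]_(m * n) | forall i, v ord0 i \in `[- T, T]].
  by apply: (@rV_compact _ _ (fun=> `[- T, T]%classic)) => _; apply: segment_compact.
have [|v [_ vY]] := K (Y @ \oo) _.
  exists 0%N => // k _ /= i; case/mxvec_indexP: i => i j.
  by rewrite /Y /= mxvecE in_itv /= -ler_norml.
exists (vec_mx v) => e e0 N.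
have [||w [[k /= Nk <-] vw]] :=
    vY (Y @` [set k | (N <= k)%N]) (ball v e).
- exists N => // k /= Nk; by exists k.
- exact: nbhsx_ballx.
exists k => // i j; move: vw => [_ /(_ 0 (mxvec_index i j))].
rewrite /Y mxvecE mxE /ball /= distrC; exact.
Qed.

(** Continuity of linear forms for the entrywise norm: expand X in elementary matrices and take for
    C the sum of the moduli of l on them. *)
Lemma scalar_bounded m n (l : 'M[R]_(m, n) -> R) : scalar l ->
  exists2 C : R, 0 <= C & forall (X : 'M[R]_(m, n)) (e : R),
    (forall i j, `|X i j| <= e) -> `|l X| <= C * e.
Proof.
move=> sl.
have lD X Y : l (X + Y) = l X + l Y by rewrite -{1}[X]scale1r sl mul1r.
have l0 : l 0 = 0 by apply: (addrI (l 0)); rewrite -lD !addr0.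
have lZ a X : l (a *: X) = a * l X by rewrite -{1}[a *: X]addr0 sl l0 addr0.
exists (\sum_i \sum_j `|l (delta_mx i j)|).
  by do 2!(apply: sumr_ge0 => ? _).
move=> X e Xe; rewrite {1}(matrix_sum_delta X) (big_morph l lD l0).
apply: le_trans (ler_norm_sum _ _ _) _; rewrite mulr_suml ler_sum // => i _.
rewrite (big_morph l lD l0).
apply: le_trans (ler_norm_sum _ _ _) _; rewrite mulr_suml ler_sum // => j _.
by rewrite lZ normrM mulrC ler_wpM2l.
Qed.

Lemma cluster_mx_le m n (X : nat -> 'M[R]_(m, n)) M (l : 'M[R]_(m, n) -> R) b :
  cluster_mx X M -> scalar l -> (forall k, l (X k) <= b + k.+1%:R^-1) -> l M <= b.
Proof.
move=> cM sl lX; rewrite leNgt; apply/negP => bM.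
have [C C0 lC] := scalar_bounded sl.
(* Half of the supposed excess: one half beats the error 1/(k+1), the other the distance from l (X
   k) to l M. *)
pose e := (l M - b) / 2; have e0 : 0 < e by rewrite /e; lra.
have C1 : 0 < C + 1 by lra.
have [N Ne] : exists N : nat, e^-1 < N%:R.
  by exists (Num.bound e^-1); rewrite archi_boundP // invr_ge0 ltW.
have [k Nk kM] := cM (e / (C + 1)) (divr_gt0 e0 C1) N.
have := lC (X k - M) (e / (C + 1)).
have -> : l (X k - M) = l (X k) - l M.
  by rewrite addrC -scaleN1r sl mulN1r addrC.
move=> h.
have {}h : `|l (X k) - l M| <= C * (e / (C + 1)).
  by apply: h => i j; rewrite !mxE ltW.
have h2 : C * (e / (C + 1)) < e.
  by rewrite mulrCA gtr_pMr // ltr_pdivrMr // mul1r; lra.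
have h3 : k.+1%:R^-1 < e.
  rewrite -[e]invrK ltf_pV2 ?posrE ?invr_gt0 ?ltr0Sn //.
  by apply: lt_le_trans Ne _; rewrite ler_nat ltnW.
have eE : l M - b = e * 2 by rewrite /e; field.
move: h (lX k) h2 h3 eE; rewrite ler_norml => /andP[+ _].
by move: (C * _) (k.+1%:R^-1) => x y; move: (e) => z; lra.
Qed.

End Cluster.

(** * Minimization of spectral functions *)

Lemma qf_delta (R : realFieldType) n (X : 'M[R]_n) i j (c : R) :
  X^T = X -> i != j ->
  qf X (delta_mx i 0 + c *: delta_mx j 0) = X i i + c * X i j *+ 2 + c ^+ 2 * X j j.
Proof.
move=> sX ij.
have E k l : delta_mx 0 k *m X *m delta_mx l (0 : 'I_1) = (X k l)%:M.
  rewrite -rowE -colE; apply/matrixP => a b.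
  by rewrite !ord1 !mxE eqxx mulr1n.
have Xji : X j i = X i j by rewrite -{1}sX mxE.
rewrite /qf !linearD /= linearZ /= !trmx_delta !mulmxDl -!scalemxAl -!scalemxAr.
by rewrite !E Xji !mxE eqxx !mulr1n; ring.
Qed.

Lemma qf_delta1 (R : realFieldType) n (X : 'M[R]_n) i :
  qf X (delta_mx i 0) = X i i.
Proof. by rewrite /qf trmx_delta -rowE -colE !mxE. Qed.

Lemma semidef_diag_ge0 (R : realFieldType) n (X : 'M[R]_n) i :
  possemidefmx X -> 0 <= X i i.
Proof. by move=> [_ pX]; rewrite -qf_delta1. Qed.

Lemma semidef_mxtrace_ge0 (R : realFieldType) n (X : 'M[R]_n) :
  possemidefmx X -> 0 <= \tr X.
Proof. by move=> pX; apply: sumr_ge0 => i _; apply: semidef_diag_ge0. Qed.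

(** Testing the form on e_i + e_j and e_i - e_j gives 2 |X i j| <= X i i + X j j. A bound on the
    trace thus bounds a minimizing sequence. *)
Lemma semidef_entry_le (R : realFieldType) n (X : 'M[R]_n) i j :
  possemidefmx X -> `|X i j| <= \tr X.
Proof.
move=> pX; have [sX qX] := pX; have d0 k := semidef_diag_ge0 k pX.
have [<-|ij] := eqVneq i j.
  rewrite ger0_norm // /mxtrace (bigD1 i) //= lerDl.
  by apply: sumr_ge0.
have : X i i + X j j <= \tr X.
  rewrite /mxtrace (bigD1 i) //= lerD2l (bigD1 j) 1?eq_sym //= lerDl.
  by apply: sumr_ge0.
have := qX (delta_mx i 0 + 1 *: delta_mx j 0).
have := qX (delta_mx i 0 + (-1) *: delta_mx j 0).
rewrite !qf_delta // => h1 h2 h3; have := d0 i; have := d0 j.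
by move=> h4 h5; rewrite ler_norml; apply/andP; split; lra.
Qed.

Lemma posdef_combine (R : realFieldType) n (X Y : 'M[R]_n) (t : R) :
  possemidefmx X -> posdefmx Y -> 0 < t -> t <= 1 ->
  posdefmx ((1 - t) *: X + t *: Y).
Proof.
move=> [sX pX] [sY pY] t0 t1; split.
  by rewrite linearD /= !linearZ /= sX sY.
move=> x x0; rewrite qfD !qfZ.
by apply: ltr_wpDl; [rewrite mulr_ge0 ?subr_ge0 | rewrite mulr_gt0 ?pY].
Qed.

Section Minimization.
Variable R : realType.
Variables (phi psi : R -> R) (N : R).
Hypothesis tangent_lt : forall a b : R, 0 < a -> 0 < b -> a != b ->
  phi a + psi a * (b - a) < phi b.
Hypothesis psi_pos : exists2 a : R, 0 < a & 0 < psi a.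
Hypothesis psi_ub : forall a : R, 0 < a -> psi a <= N.
Hypothesis psi_mul_lb : forall a : R, 0 < a -> - N <= psi a * a.
Hypothesis psi_ninfty : forall M : R, exists2 e : R, 0 < e &
  forall a : R, 0 < a -> a <= e -> psi a < M.

Let N_ge0 : 0 <= N.
Proof. by case: psi_pos => a a0 pa; have := psi_ub a0; lra. Qed.

Variables (n : nat) (W : 'M[R]_n -> 'M[R]_n) (obj : 'M[R]_n -> R) (X0 : 'M[R]_n).
Hypothesis W_linear : linear W.
Hypothesis objE : forall X, posdefmx X ->
  exists U d, eigdecmx X U d /\ obj X = \sum_i phi (d 0 i).

Definition feasible_mx X := posdefmx X /\ W X = 0.

Hypothesis feas0 : feasible_mx X0.

(** The linear form Y -> tr (psi(X) Y), where U and a diagonalize X. *)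
Let psiform (U : 'M[R]_n) (a : 'rV[R]_n) (Y : 'M[R]_n) :=
  \sum_i psi (a 0 i) * qf Y (col i U).

Let psiform_scalar U a : scalar (psiform U a).
Proof.
move=> c Y Z; rewrite /psiform mulr_sumr -big_split /=.
by apply: eq_bigr => i _; rewrite qfD qfZ; ring.
Qed.

Let qf_scalar x : scalar (fun Y : 'M[R]_n => qf Y x).
Proof. by move=> c Y Z; rewrite qfD qfZ. Qed.

Let obj_klein X : posdefmx X -> exists U a, eigdecmx X U a /\
  forall Y, posdefmx Y -> obj X + psiform U a Y - psiform U a X <= obj Y /\
   (X != Y -> obj X + psiform U a Y - psiform U a X < obj Y).
Proof.
move=> pX; have [U [a [XUa XE]]] := objE pX; exists U, a; split => // Y pY.
have [V [b [YVb YE]]] := objE pY.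
have -> : obj X + psiform U a Y - psiform U a X =
  \sum_i phi (a 0 i) + \sum_i psi (a 0 i) * (qf Y (col i U) - a 0 i).
  rewrite XE -addrA; congr (_ + _); rewrite /psiform -sumrB; apply: eq_bigr => i _.
  by rewrite (eigdec_qf_col XUa) mulrBr.
rewrite YE; split; first exact: (klein_le tangent_lt XUa YVb).
exact: (klein_lt tangent_lt XUa YVb).
Qed.

Let W_combine (X Y : 'M[R]_n) (t : R) :
  W X = 0 -> W Y = 0 -> W ((1 - t) *: X + t *: Y) = 0.
Proof.
have WZ c Z : W Z = 0 -> W (c *: Z) = 0.
  move=> Z0; have := W_linear (c - 1) Z Z.
  by rewrite Z0 scaler0 addr0 -{2}[Z]scale1r -scalerDl subrK.
by move=> X00 Y0; rewrite W_linear X00 scaler0 add0r WZ.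
Qed.

(** Sum over the eigenvalues the tangent to phi at a point where its slope is positive. *)
Let obj_coercive : exists c K : R, 0 < c /\
  forall X, posdefmx X -> c * \tr X + K <= obj X.
Proof.
have [a a0 pa] := psi_pos; exists (psi a), (\sum_(i < n) (phi a - psi a * a)).
split=> // X pX; have [U [d [XUd ->]]] := objE pX.
rewrite (eigdec_mxtrace XUd) mulr_sumr -big_split /= ler_sum // => i _.
have d0 := eigdec_gt0 XUd i pX.
have [<-|ad] := eqVneq a (d 0 i); first by lra.
by have := tangent_lt a0 d0 ad; lra.
Qed.

Theorem spectral_minimizer : exists X, [/\ feasible_mx X,
  forall Y, feasible_mx Y -> obj X <= obj Y &
  forall Y, feasible_mx Y -> obj Y <= obj X -> Y = X].
Proof.
suff [X [fX minX]] : exists X, feasible_mx X /\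
    forall Y, feasible_mx Y -> obj X <= obj Y.
  exists X; split => // Y fY YX; apply/eqP/negPn/negP => neq.
  (* Add Klein's inequalities at the midpoint Z towards X and towards Y: the linear terms cancel
     and, the second being strict, 2 obj Z < obj X + obj Y <= 2 obj X. *)
  pose Z := (1 - 2^-1) *: X + 2^-1 *: Y.
  have ZE : Z = 2^-1 *: X + 2^-1 *: Y.
    by rewrite /Z; congr (_ *: _ + _); field.
  have h0 : 0 < 2^-1 :> R by lra.
  have h1 : 2^-1 <= 1 :> R by lra.
  have pZ : posdefmx Z.
    by apply: posdef_combine => //; [apply/posdef_semidef; apply fX | apply fY].
  have fZ : feasible_mx Z by split => //; apply: W_combine; [apply fX | apply fY].
  have ZY : Z != Y.
    apply: contra neq => /eqP ZY; rewrite eq_sym -subr_eq0.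
    have : 2^-1 *: (X - Y) = 0.
      rewrite scalerBr -[X in _ - X](addrK (2^-1 *: Y)) -scalerDl.
      rewrite (_ : 2^-1 + 2^-1 = 1 :> R); last by field.
      by rewrite scale1r opprB addrA -ZE ZY subrr.
    by move/eqP; rewrite scaler_eq0 invr_eq0 pnatr_eq0.
  have [U [a [_ kl]]] := obj_klein pZ.
  have [k1 _] := kl _ (proj1 fX); have [_ /(_ ZY) k2] := kl _ (proj1 fY).
  have := minX _ fZ; move: k1 k2.
  have -> : psiform U a Z = 2^-1 * psiform U a X + 2^-1 * psiform U a Y.
    rewrite ZE psiform_scalar; congr (_ + _).
    have := psiform_scalar U a (2^-1) Y 0; rewrite addr0 => ->.
    rewrite (_ : psiform U a 0 = 0) ?addr0 // /psiform big1 // => i _.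
    by rewrite /qf mulmx0 mul0mx mxE mulr0.
  by lra.
have [c [K [c0 co]]] := obj_coercive.
pose E := [set obj X | X in feasible_mx]%classic.
have infE : has_inf E.
  split; first by exists (obj X0), X0.
  exists K => _ [X [pX _] <-].
  apply: le_trans (co X pX); rewrite lerDr mulr_ge0 ?(ltW c0) //.
  exact/semidef_mxtrace_ge0/posdef_semidef.
have inf_le X : feasible_mx X -> inf E <= obj X.
  by move=> fX; apply: ge_inf; [apply infE | exists X].
have /choice [X XP] : forall k : nat, exists X,
    feasible_mx X /\ obj X < inf E + k.+1%:R^-1.
  move=> k; have k0 : 0 < k.+1%:R^-1 :> R by rewrite invr_gt0 ltr0Sn.
  have [_ [X fX <-] oX] := inf_adherent k0 infE.
  by exists X.
(* Along the sequence obj is at most inf E + 1, so coercivity bounds the traces, and these bound the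
   entries. *)
have [M cM] : exists M, cluster_mx X M.
  apply: (@bounded_cluster_mx _ _ _ _ ((inf E + 1 - K) / c)) => k i j.
  have [[pX _] oX] := XP k.
  apply: le_trans (semidef_entry_le _ _ (posdef_semidef pX)) _.
  rewrite ler_pdivlMr // mulrC.
  have := co _ pX; have : k.+1%:R^-1 <= 1 :> R by rewrite invf_le1 ?ltr0Sn // ler1n.
  by move: oX; move: (k.+1%:R^-1) => y; lra.
have lim_ge (l : 'M[R]_n -> R) b : scalar l -> (forall k, l (X k) <= b) -> l M <= b.
  move=> sl lX; apply: cluster_mx_le cM sl _ => k; rewrite (le_trans (lX k)) //.
  by rewrite lerDl invr_ge0.
have lim_eq (l : 'M[R]_n -> R) : scalar l -> (forall k, l (X k) = 0) -> l M = 0.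
  move=> sl lX; apply/eqP.
  rewrite eq_le (lim_ge l 0 sl) //=; last by move=> k; rewrite lX.
  rewrite -oppr_le0; apply: (lim_ge (fun Y => - l Y)).
    by move=> a Y Z; rewrite sl opprD mulrN.
  by move=> k; rewrite lX oppr0.
have pM : possemidefmx M.
  split.
    apply/matrixP => i j; rewrite mxE; apply/eqP; rewrite -subr_eq0; apply/eqP.
    apply: (lim_eq (fun Y : 'M[R]_n => Y j i - Y i j)).
      by move=> a Y Z; rewrite !mxE; ring.
    by move=> k; have [[[sX _] _] _] := XP k; rewrite -{2}sX mxE subrr.
  move=> x; rewrite -oppr_le0; apply: (lim_ge (fun Y => - qf Y x)).
    by move=> a Y Z; rewrite qf_scalar opprD mulrN.
  by move=> k; have [[pX _] _] := XP k; rewrite oppr_le0; apply (posdef_semidef pX).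
have WM : W M = 0.
  apply/matrixP => i j; rewrite [RHS]mxE.
  apply: (lim_eq (fun Y => W Y i j)).
    by move=> a Y Z; rewrite W_linear !mxE.
  by move=> k; have [[_ ->] _] := XP k; rewrite mxE.
(* Klein's inequality at Z is affine in its second argument, so it passes from X k to M even if M is
   singular. *)
have key Z : feasible_mx Z -> exists U a, eigdecmx Z U a /\
    psiform U a M <= inf E - obj Z + psiform U a Z.
  move=> [pZ _]; have [U [a [ZUa kl]]] := obj_klein pZ.
  exists U, a; split => //; apply: cluster_mx_le cM (psiform_scalar U a) _ => k.
  have [[pX _] oX] := XP k.
  by have [] := kl _ pX; move: oX; move: (k.+1%:R^-1) => y; lra.
(* Once M is feasible, [key] at M itself reads obj M <= inf E. *)
suff pdM : posdefmx M.
  exists M; split => // Y fY; have [U [a [_ h]]] := key M (conj pdM WM).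
  by have := inf_le _ fY; lra.
split; first by case: pM.
move=> v v0; rewrite lt_def (proj2 pM) andbT; apply/eqP => Mv.
have [c1 c10 X0c] := posdef_lower_bound (proj1 feas0).
(* The Rayleigh quotient of X0 at the null direction v of M: that of (1 - t) M + t X0 is then t *
   kap, which bounds its least eigenvalue. *)
pose kap := qf X0 v / qf 1%:M v.
have v1 : 0 < qf 1%:M v by rewrite qf1_gt0.
have kap0 : 0 < kap by rewrite divr_gt0 //; apply (proj2 (proj1 feas0)).
(* Sum over all j of the bounds N q_j + 2 N in [term] below, the q_j adding up to the trace of
   X0. *)
pose B := N * \tr X0 + N * 2 *+ n.
have B0 : 0 <= B.
  rewrite addr_ge0 ?mulrn_wge0 ?mulr_ge0 //.
  exact/semidef_mxtrace_ge0/posdef_semidef/(proj1 feas0).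
have [e e0 psie] := psi_ninfty (- (B / c1)).
(* t <= 1/2 gives p_i <= 2 a_i below; t * kap <= e pushes the least eigenvalue of Z to where psi is
   below - B / c1. *)
pose t := Num.min 2^-1 (e / kap).
have t0 : 0 < t by rewrite lt_min invr_gt0 ltr0Sn divr_gt0.
have t2 : t <= 2^-1 by rewrite ge_min lexx.
have te : t * kap <= e by rewrite -ler_pdivlMr // ge_min lexx orbT.
pose Z := (1 - t) *: M + t *: X0.
have pZ : posdefmx Z by apply: posdef_combine => //; [apply (proj1 feas0) | lra].
have fZ : feasible_mx Z by split => //; apply: W_combine => //; apply (proj2 feas0).
have [U [a [ZUa h]]] := key Z fZ.
(* As inf E <= obj Z, [key] at Z gives psiform M <= psiform Z; by linearity the difference is t
   times the one claimed. *)
have hX : 0 <= psiform U a X0 - psiform U a M.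
  have := inf_le _ fZ.
  have ZE : psiform U a Z = (1 - t) * psiform U a M + t * psiform U a X0.
    rewrite /Z psiform_scalar; congr (_ + _).
    rewrite /psiform mulr_sumr; apply: eq_bigr => i _; rewrite qfZ; ring.
  have : psiform U a Z - psiform U a M = t * (psiform U a X0 - psiform U a M).
    by rewrite ZE; ring.
  move=> h1 h2; have : 0 <= t * (psiform U a X0 - psiform U a M) by rewrite -h1; lra.
  by rewrite pmulr_rge0.
pose p i := qf M (col i U); pose q i := qf X0 (col i U).
have p0 i : 0 <= p i by apply (proj2 pM).
have q1 i : c1 <= q i.
  by have := X0c (col i U); rewrite (eigdec_qf1_col ZUa) mulr1.
have a0 i : 0 < a 0 i := eigdec_gt0 ZUa i pZ.
have apq i : a 0 i = (1 - t) * p i + t * q i.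
  by rewrite -(eigdec_qf_col ZUa) /Z qfD !qfZ.
have pa i : p i <= 2 * a 0 i.
  have : 2^-1 * p i <= (1 - t) * p i by rewrite ler_wpM2r //; lra.
  have : 0 <= t * q i by rewrite mulr_ge0 ?ltW //; have := q1 i; lra.
  by rewrite apq; lra.
(* For psi <= 0, use q_i >= c1 in the first product and p_i <= 2 a_i with psi(a_i) a_i >= - N in the
   second. *)
have npsi i : psi (a 0 i) <= 0 -> psi (a 0 i) * (q i - p i) <= c1 * psi (a 0 i) + N * 2.
  move=> ps.
  have : psi (a 0 i) * q i <= psi (a 0 i) * c1 by rewrite ler_wnM2l.
  have : psi (a 0 i) * (2 * a 0 i) <= psi (a 0 i) * p i by rewrite ler_wnM2l.
  by have := psi_mul_lb (a0 i); lra.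
have term i : psi (a 0 i) * (q i - p i) <= N * q i + N * 2.
  have qi0 : 0 <= q i by have := q1 i; lra.
  have Nq : 0 <= N * q i by rewrite mulr_ge0.
  have [ps|/ltW ps] := leP (psi (a 0 i)) 0.
    have : c1 * psi (a 0 i) <= 0 by rewrite pmulr_rle0.
    by have := npsi _ ps; lra.
  have : psi (a 0 i) * q i <= N * q i by rewrite ler_wpM2r ?psi_ub.
  have : 0 <= psi (a 0 i) * p i by rewrite mulr_ge0.
  by have := N_ge0; lra.
have [i ai] : exists i, a 0 i <= t * kap.
  apply: contrapT => /forallNP nex.
  suff : t * kap * qf 1%:M v < qf Z v.
    rewrite /Z qfD !qfZ Mv mulr0 add0r -mulrA divfK ?ltxx // gt_eqF //.
  have sn0 : \sum_i (U^T *m v) i 0 ^+ 2 != 0 by rewrite -(eigdec_qf1 ZUa) qf1_eq0.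
  rewrite (eigdec_qf ZUa) (eigdec_qf1 ZUa) mulr_sumr.
  have [i vi] : exists i, (U^T *m v) i 0 != 0.
    apply: contrapT => /forallNP al; move/eqP: sn0; apply; apply: big1 => i _.
    by have /negP := al i; rewrite negbK => /eqP ->; rewrite expr0n.
  have lt j : t * kap < a 0 j by rewrite ltNge; apply/negP/nex.
  rewrite (bigD1 i) //= [X in _ < X](bigD1 i) //=; apply: ltr_leD.
    by rewrite ltr_pM2r // lt_def sqr_ge0 sqrf_eq0 vi.
  by apply: ler_sum => j _; rewrite ler_wpM2r ?sqr_ge0 // ltW.
have psi_i := psie _ (a0 i) (le_trans ai te).
(* Every index other than i is bounded by [term]; the index i alone makes the right-hand side
   negative, against [hX]. *)
have : psiform U a X0 - psiform U a M <= c1 * psi (a 0 i) + B.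
  have trq : \tr X0 = \sum_j q j.
    have [UU _] := ZUa; rewrite -[X0]mulmx1 -(eigdec_mulmxV ZUa) mulmxA mxtrace_mulC.
    by apply: eq_bigr => j _; rewrite /q qf_col mulmxA.
  have -> : B = \sum_j (N * q j + N * 2).
    by rewrite big_split /= sumr_const card_ord -mulr_sumr -trq.
  rewrite /psiform -sumrB (bigD1 i) //= [X in _ <= _ + X](bigD1 i) //= addrA.
  apply: lerD; last first.
    by apply: ler_sum => j _; rewrite -mulrBr; apply: term.
  rewrite -mulrBr -/(q i) -/(p i); have : psi (a 0 i) <= 0.
    apply: le_trans (ltW psi_i) _; rewrite oppr_le0 divr_ge0 ?(ltW c10) //.
  move/npsi; have : 0 <= N * q i by rewrite mulr_ge0 // (le_trans _ (q1 i)) // ltW.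
  by lra.
have : c1 * psi (a 0 i) < - B by rewrite mulrC -ltr_pdivlMr // mulNr.
by lra.
Qed.

End Minimization.

(** * Powers of a stable matrix *)

Section GeometricDecay.
Variable C : numFieldType.

Definition geometric_decay (x : nat -> C) :=
  exists c r : C, [/\ 0 <= c, 0 <= r, r < 1 & forall k, `|x k| <= c * r ^+ k].

(** For a rate s strictly between max(|l|, r) and 1, the constant D = |x 0| + c / (s - |l|)
    satisfies |l| D + c <= s D, which closes the induction. *)
Lemma geometric_decay_recursion (l : C) (x : nat -> C) : `|l| < 1 ->
  geometric_decay (fun k => x k.+1 - l * x k) -> geometric_decay x.
Proof.
move=> l1 [c [r [c0 r0 r1 yc]]].
(* The order of C is only partial, so the maximum needs comparable arguments; both are real. *)
have cmp : `|l| >=< r by apply: real_comparable; rewrite ?normr_real ?ger0_real.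
pose m := Num.max `|l| r; pose s := (m + 1) / 2.
have ml : `|l| <= m by rewrite comparable_le_max ?lexx.
have mr : r <= m by rewrite comparable_le_max ?lexx ?orbT.
have m1 : m < 1 by rewrite comparable_gt_max ?l1.
have ms : m < s by rewrite midf_lt.
have s1 : s < 1 by rewrite midf_lt.
have ls : 0 < s - `|l| by rewrite subr_gt0 (le_lt_trans ml).
have s0 : 0 <= s by rewrite (le_trans r0) // (le_trans mr) ?ltW.
have d0 : 0 <= `|x 0%N| + c / (s - `|l|) by rewrite addr_ge0 ?divr_ge0 ?(ltW ls).
exists (`|x 0%N| + c / (s - `|l|)), s; split => //.
elim=> [|k IH]; first by rewrite expr0 mulr1 lerDl divr_ge0 ?(ltW ls).
have -> : x k.+1 = l * x k + (x k.+1 - l * x k) by rewrite addrC subrK.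
apply: le_trans (ler_normD _ _) _; rewrite normrM.
have : `|l| * `|x k| <= `|l| * ((`|x 0%N| + c / (s - `|l|)) * s ^+ k).
  by rewrite ler_wpM2l.
move=> h1; have h2 : `|x k.+1 - l * x k| <= c * s ^+ k.
  apply: le_trans (yc k) _; rewrite ler_wpM2l // lerXn2r ?nnegrE //.
  by rewrite (le_trans mr) ?ltW.
apply: le_trans (lerD h1 h2) _.
rewrite exprS -subr_ge0.
rewrite [X in 0 <= X](_ : _ = (s - `|l|) * `|x 0%N| * s ^+ k); last first.
  by move: ls; rewrite lt0r => /andP[+ _]; move: (s) => u u0; field.
by rewrite !mulr_ge0 ?exprn_ge0 // ltW.
Qed.

End GeometricDecay.

(* Peeling off one root of the characteristic polynomial at a time,
   Cayley-Hamilton supplying the start. *)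
Lemma mxpow_decay (R : rcfType) n (A : 'M[R[i]]_n.+1) :
  (forall l, eigenvalue A l -> `|l| < 1) ->
  forall i j, geometric_decay (fun k => (A ^+ k) i j).
Proof.
move=> Al.
have [s sE] := closed_field_poly_normal (char_poly A).
have sl l : l \in s -> `|l| < 1.
  move=> ls; apply: Al; rewrite eigenvalue_root_char sE rootZ; last first.
    by rewrite lead_coef_eq0 monic_neq0 ?char_poly_monic.
  by rewrite root_prod_XsubC.
pose P (t : seq R[i]) := horner_mx A (\prod_(z <- t) ('X - z%:P)).
have Ps : P s = 0.
  by have := Cayley_Hamilton A; rewrite sE (monicP (char_poly_monic A)) scale1r.
have : forall i j, geometric_decay (fun k => (P s * A ^+ k) i j).
  move=> i j; rewrite Ps; exists 0, 0; split; rewrite ?ltr01 // => k.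
  by rewrite mul0r mxE normr0 mul0r.
elim: s sl {sE Ps} => [|z s IH] sl dec.
  move=> i j; have [c [r [c0 r0 r1 h]]] := dec i j; exists c, r; split => // k.
  by have := h k; rewrite /P big_nil rmorph1 mul1r.
apply: IH => [l ls|i j]; first by apply: sl; rewrite inE ls orbT.
apply: (@geometric_decay_recursion _ z); first by apply: sl; rewrite mem_head.
have [c [r [c0 r0 r1 h]]] := dec i j; exists c, r; split => // k.
(* P (z :: s) A^k = P s A^(k+1) - z P s A^k, which is the recursion with multiplier z. *)
have := h k; rewrite /P big_cons mulrC rmorphM rmorphB /= horner_mx_X horner_mx_C.
rewrite mulrBr mulrBl -mulrA -exprS -[_ * z%:M]/(_ *m z%:M) mul_mx_scalar.
by rewrite -scalerAl !mxE.
Qed.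

Lemma complex_sum (R : pzRingType) (I : Type) (r : seq I) (f g : I -> R) :
  ((\sum_(i <- r) f i) +i* (\sum_(i <- r) g i))%C = \sum_(i <- r) (f i +i* g i)%C.
Proof. by elim: r => [|i r IH]; rewrite ?big_nil // !big_cons -IH. Qed.

Lemma trmx_expr (R : comNzRingType) n (A : 'M[R]_n.+1) k : (A^T) ^+ k = (A ^+ k)^T.
Proof.
by elim: k => [|k IH]; rewrite ?expr0 ?trmx1 // exprS IH exprSr [RHS]trmx_mul.
Qed.

Lemma map_mx_expr (R S : comNzRingType) (f : {rmorphism R -> S}) n (A : 'M[R]_n.+1) k :
  (map_mx f A) ^+ k = map_mx f (A ^+ k).
Proof.
by elim: k => [|k IH]; rewrite ?expr0 ?map_mx1 // !exprS IH [RHS]map_mxM.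
Qed.

Section StablePowers.
Variable R : realType.

Lemma geometric_small (c r e : R) : 0 <= r -> r < 1 -> 0 < e ->
  exists K, forall k, (K <= k)%N -> c * r ^+ k < e.
Proof.
move=> r0 r1 e0.
have : ((fun k => c * r ^+ k) @ \oo --> c * 0)%classic.
  by apply: cvgMr; apply: cvg_expr; rewrite ger0_norm.
rewrite mulr0 => /cvgrPdist_lt /(_ e e0) [K _ h]; exists K => k Kk.
by have := h k Kk; rewrite sub0r normrN; apply: le_lt_trans; apply: ler_norm.
Qed.

Lemma stable_mxpow_small n (A : 'M[R]_n.+1) :
  (forall a b (x y : 'cV[R]_n.+1), x != 0 \/ y != 0 ->
     A *m x = a *: x - b *: y -> A *m y = b *: x + a *: y -> a * a + b * b < 1) ->
  forall e : R, 0 < e -> exists K, forall k, (K <= k)%N ->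
    forall i j, `|(A ^+ k) i j| < e.
Proof.
move=> stab e e0.
(* [eigenvalue] speaks of row vectors and the hypothesis of columns, hence the transpose; x and y
   are the real and imaginary parts of the eigenvector. *)
have eig l : eigenvalue (map_mx (real_complex R) A^T) l -> `|l| < 1.
  case: l => a b /eigenvalueP [v vA v0].
  pose x : 'cV[R]_n.+1 := \col_i complex.Re (v 0 i).
  pose y : 'cV[R]_n.+1 := \col_i complex.Im (v 0 i).
  have vE i : v 0 i = (x i 0 +i* y i 0)%C by rewrite !mxE; case: (v 0 i).
  have AE i : ((A *m x) i 0 +i* (A *m y) i 0)%C =
      ((a * x i 0 - b * y i 0) +i* (b * x i 0 + a * y i 0))%C.
    have := congr1 (fun M : 'rV_n.+1 => M 0 i) vA; rewrite /= !mxE vE => vAi.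
    transitivity ((a +i* b)%C * (x i 0 +i* y i 0)%C); last first.
      by apply/eqP; rewrite eq_complex /= eqxx /= addrC.
    rewrite -vAi complex_sum; apply: eq_bigr => k _.
    rewrite vE [map_mx _ _ _ _]mxE [_^T _ _]mxE.
    by apply/eqP; rewrite eq_complex /=; apply/andP; split; apply/eqP; ring.
  have : a * a + b * b < 1.
    apply: (stab a b x y).
    - apply/orP; rewrite -negb_and; apply: contra v0 => /andP[/eqP x0 /eqP y0].
      by apply/eqP/rowP => i; rewrite vE x0 y0 !mxE.
    - by apply/colP => i; have [-> _] := AE i; rewrite !mxE.
    - by apply/colP => i; have [_ ->] := AE i; rewrite !mxE.
  rewrite normc_def /= => ab; rewrite -[1]/(1%:C%C) ltcR.
  by rewrite -sqrtr1 ltr_sqrt // !expr2.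
have dec := mxpow_decay eig.
have dec1 i j : exists K, forall k, (K <= k)%N -> `|(A ^+ k) j i| < e.
  have [c [r [c0 r0 r1 h]]] := dec i j.
  (* c and r are complex numbers, but being non-negative they are real. *)
  have cE : c = (complex.Re c)%:C%C by rewrite RRe_real // ger0_real.
  have rE : r = (complex.Re r)%:C%C by rewrite RRe_real // ger0_real.
  have r0' : 0 <= complex.Re r by rewrite -lecR -rE.
  have r1' : complex.Re r < 1 by rewrite -ltcR -rE.
  have [K KP] := geometric_small (complex.Re c) r0' r1' e0.
  exists K => k Kk; apply: le_lt_trans (KP k Kk).
  have := h k; rewrite map_mx_expr trmx_expr 2!mxE cE rE -rmorphXn -rmorphM /=.
  by rewrite normc_def /= expr0n addr0 sqrtr_sqr lecR.
have /choice [K KP] : forall ij : 'I_n.+1 * 'I_n.+1, exists K, forall k, (K <= k)%N ->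
    `|(A ^+ k) ij.2 ij.1| < e by case=> i j; apply: dec1.
exists (\max_ij K ij) => k Kk i j.
by apply: (KP (j, i)); apply: leq_trans Kk; apply: leq_bigmax.
Qed.

End StablePowers.

(** * Lyapunov equation and Cholesky factor *)

Section Lyapunov.
Variables (R : realType) (n : nat) (A : 'M[R]_n.+1).

Definition lyapunov (Q : 'M[R]_n.+1) := Q - A *m Q *m A^T.

Lemma lyapunov_is_linear : linear lyapunov.
Proof.
move=> c X Y; rewrite /lyapunov mulmxDr mulmxDl -scalemxAr -scalemxAl.
by rewrite scalerBr opprD addrACA.
Qed.

HB.instance Definition _ :=
  GRing.isLinear.Build R 'M[R]_n.+1 'M[R]_n.+1 _ lyapunov lyapunov_is_linear.

Hypothesis A_small : forall e : R, 0 < e -> exists K, forall k, (K <= k)%N ->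
  forall i j, `|(A ^+ k) i j| < e.

Lemma mxpow_congrS k Q : A ^+ k.+1 *m Q *m (A ^+ k.+1)^T =
  A ^+ k *m (A *m Q *m A^T) *m (A ^+ k)^T.
Proof. by rewrite exprSr [(_ * _)^T]trmx_mul -[_ * A]/(_ *m A) !mulmxA. Qed.

Lemma mxpow_congr_small Q (e : R) : 0 < e -> exists K, forall k, (K <= k)%N ->
  forall i j, `|(A ^+ k *m Q *m (A ^+ k)^T) i j| < e.
Proof.
move=> e0; pose T := \sum_p \sum_l `|Q l p|.
have T0 : 0 <= T by do 2!(apply: sumr_ge0 => ? _).
(* The bound 1 absorbs the right factor (A^k)^T; the bound e / (T + 1) on the left factor makes the
   whole smaller than e. *)
pose d := Num.min 1 (e / (T + 1)).
have d0 : 0 < d by rewrite lt_min ltr01 divr_gt0 //; lra.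
have [K KP] := A_small d0; exists K => k Kk i j.
apply: (@le_lt_trans _ _ (T * d)); last first.
  apply: (@le_lt_trans _ _ (T * (e / (T + 1)))).
    by rewrite ler_wpM2l // ge_min lexx orbT.
  by rewrite mulrCA gtr_pMr // ltr_pdivrMr ?mul1r; lra.
rewrite mxE; apply: le_trans (ler_norm_sum _ _ _) _; rewrite mulr_suml.
apply: ler_sum => p _; rewrite !mxE normrM mulr_suml.
apply: (@le_trans _ _ (`|\sum_l (A ^+ k) i l * Q l p| * 1)).
  rewrite ler_wpM2l // (le_trans (ltW (KP k Kk _ _))) // ge_min lexx //.
rewrite mulr1; apply: le_trans (ler_norm_sum _ _ _) _; apply: ler_sum => l _.
by rewrite normrM mulrC ler_wpM2l // ltW // KP.
Qed.

(** A kernel element satisfies Z = A^k Z (A^k)^T for all k, and the right-hand side tends to 0. *)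
Lemma lyapunov_injective : injective lyapunov.
Proof.
move=> X Y XY; apply/eqP; rewrite -subr_eq0; apply/eqP.
have : lyapunov (X - Y) = 0 by rewrite linearB /= XY subrr.
move: (X - Y) => Z /eqP; rewrite subr_eq0 => /eqP ZE.
have Zk k : Z = A ^+ k *m Z *m (A ^+ k)^T.
  elim: k => [|k IH]; first by rewrite expr0 mul1mx trmx1 mulmx1.
  by rewrite mxpow_congrS -ZE.
apply/matrixP => i j; rewrite mxE; apply/eqP; rewrite -normr_eq0 eq_le normr_ge0 andbT.
rewrite leNgt; apply/negP => /(mxpow_congr_small Z) [K /(_ K (leqnn K) i j)].
by rewrite -Zk ltxx.
Qed.

(** An injective endomorphism of a finite-dimensional space is invertible. *)
Lemma lyapunov_surjective Y : exists X, lyapunov X = Y.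
Proof.
have ker0 : lker (linfun lyapunov) == 0%VS.
  by apply/lker0P => X Y0; rewrite !lfunE; apply: lyapunov_injective.
exists ((linfun lyapunov)^-1%VF Y).
by have := lker0_lfunVK ker0 Y; rewrite lfunE.
Qed.

Lemma lyapunov_posdef m (B : 'M[R]_(n.+1, m)) :
  (forall w : 'cV[R]_n.+1, w != 0 ->
     exists2 k, (k < n.+1)%N & w^T *m A ^+ k *m B != 0) ->
  exists2 Q, posdefmx Q & Q - A *m Q *m A^T = B *m B^T.
Proof.
move=> reach; have [Q QB] := lyapunov_surjective (B *m B^T).
exists Q => //; split.
  (* Q^T solves the same equation, since B B^T is symmetric. *)
  apply: lyapunov_injective; rewrite QB.
  have -> : lyapunov Q^T = (lyapunov Q)^T.
    by rewrite /lyapunov [RHS]linearB /= !trmx_mul trmxK mulmxA.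
  by rewrite QB trmx_mul trmxK.
move=> w w0.
pose s k := qf 1%:M (B^T *m (A ^+ k)^T *m w).
have s0 k : 0 <= s k by apply: qf1_ge0.
have tele N : qf Q w = \sum_(k < N) s k + qf (A ^+ N *m Q *m (A ^+ N)^T) w.
  elim: N => [|N IH]; first by rewrite big_ord0 add0r expr0 mul1mx trmx1 mulmx1.
  rewrite IH big_ord_recr /= -addrA; congr (_ + _).
  rewrite -{1}[Q](subrK (A *m Q *m A^T)) -/(lyapunov Q) QB.
  rewrite mulmxDr mulmxDl qfD; congr (_ + _).
    by rewrite /s /qf mulmx1 !trmx_mul !trmxK !mulmxA.
  by rewrite mxpow_congrS.
have [k0 k0n wk] := reach w w0.
have sk : 0 < s k0.
  apply: qf1_gt0; apply: contra wk => /eqP z.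
  rewrite -[_ *m B]trmxK (_ : (_ *m B)^T = 0) ?trmx0 // -z.
  by rewrite !trmx_mul trmxK mulmxA.
have sl : scalar (fun Y => qf Y w) by move=> c X Y; rewrite qfD qfZ.
have [C C0 lC] := scalar_bounded sl.
have C1 : 0 < C + 1 by lra.
have [K KP] := mxpow_congr_small Q (divr_gt0 sk C1).
(* From K on the remainder is smaller than s k0, and from n.+1 on the sum contains the positive term
   s k0. *)
pose N := maxn K n.+1.
have := lC _ _ (fun i j => ltW (KP N (leq_maxl _ _) i j)).
have : C * (s k0 / (C + 1)) < s k0.
  by rewrite mulrCA gtr_pMr // ltr_pdivrMr // mul1r; lra.
rewrite (tele N) ler_norml => h1 /andP[h2 _].
have k0N : (k0 < N)%N by rewrite (leq_trans k0n) // leq_maxr.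
have : s k0 <= \sum_(k < N) s k.
  by rewrite (bigD1 (Ordinal k0N)) //= lerDl sumr_ge0.
by lra.
Qed.

End Lyapunov.

(** Induction on the dimension through the Schur complement S of the upper left entry q, with first
    column of the factor (sqrt q, r / sqrt q). *)
Lemma posdef_cholesky (R : rcfType) n (Q : 'M[R]_n) : posdefmx Q ->
  exists L : 'M[R]_n, [/\ forall i j : 'I_n, (i < j)%N -> L i j = 0,
    forall i, 0 < L i i & L *m L^T = Q].
Proof.
elim: n Q => [|n IH] Q pQ.
  by exists 1%:M; split => [[]|[]|] //; apply/matrixP => -[].
have [sQ qQ] := pQ.
pose Q1 : 'M[R]_(1 + n) := Q.
pose q := Q 0 0; pose r := dlsubmx Q1.
have q0 : 0 < q.
  rewrite /q -qf_delta1 qQ //; apply/eqP => /matrixP/(_ 0 0)/eqP.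
  by rewrite !mxE !eqxx oner_eq0.
have ul : ulsubmx Q1 = q%:M.
  by apply/matrixP => i j; rewrite !ord1 !mxE lshift0 eqxx mulr1n.
have ur : ursubmx Q1 = r^T by rewrite /r trmx_dlsub [Q1^T]sQ.
have QE : Q1 = block_mx q%:M r^T r (drsubmx Q1) by rewrite -{1}[Q1]submxK ul ur.
pose S := drsubmx Q1 - q^-1 *: (r *m r^T).
have pS : posdefmx S.
  split.
    by rewrite /S linearB /= linearZ /= trmx_mul trmxK trmx_drsub [Q1^T]sQ.
  move=> x x0.
  (* This first coordinate minimizes the form of Q for given x, and the minimum is the form of S. *)
  have : 0 < qf Q1 (col_mx (- (q^-1 *: (r^T *m x))) x).
    apply: qQ; apply: contra x0 => /eqP/(congr1 (@dsubmx R 1 n 1)).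
    by rewrite col_mxKd linear0 => ->.
  set y := - _; have yT : y^T = - (q^-1 *: (x^T *m r)).
    by rewrite /y linearN /= linearZ /= trmx_mul trmxK.
  congr (0 < _).
  rewrite QE /qf tr_col_mx mul_row_block mul_row_col mul_mx_scalar {1}yT.
  rewrite scalerN scalerA mulfV ?gt_eqF // scale1r addNr mul0mx add0r yT.
  rewrite /S mulmxBr mulmxBl mulNmx mulmxDl mulNmx addrC -scalemxAl -scalemxAr.
  by rewrite -!scalemxAl !mulmxA.
have [L [Lt Ld LL]] := IH S pS.
pose s := Num.sqrt q.
have s0 : 0 < s by rewrite sqrtr_gt0.
pose Lb : 'M[R]_(1 + n) := block_mx s%:M 0 (s^-1 *: r) L.
have Lb_trig (i j : 'I_(1 + n)) : (i < j)%N -> Lb i j = 0.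
  case: (split_ordP i) => i' ->; case: (split_ordP j) => j' ->.
  + by rewrite !ord1.
  + by rewrite /Lb block_mxEur mxE.
  + by rewrite !ord1.
  + by rewrite /Lb block_mxEdr /= ltn_add2l; apply: Lt.
have Lb_diag (i : 'I_(1 + n)) : 0 < Lb i i.
  case: (split_ordP i) => i' ->.
  + by rewrite /Lb block_mxEul ord1 mxE eqxx mulr1n.
  + by rewrite /Lb block_mxEdr.
have ss : s * s = q by rewrite -expr2 sqr_sqrtr // ltW.
have LbE : Lb *m Lb^T = Q1.
  rewrite QE tr_block_mx mulmx_block !trmx0 !mul0mx !mulmx0 !addr0.
  rewrite tr_scalar_mx linearZ /= -scalar_mxM ss mul_mx_scalar.
  rewrite mul_scalar_mx !scalerA mulfV ?gt_eqF // !scale1r LL -scalemxAl -scalemxAr.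
  by rewrite scalerA -invfM ss /S addrC subrK.
by exists Lb.
Qed.

(** * Transfer to the concrete matrices *)

(** Klein's inequality between two decompositions of one matrix has zero linear term, and it applies
    both ways. This reconciles decompositions that arise from different choices. *)
Lemma eigdec_sum_unique (R : rcfType) (phi psi : R -> R) n (X U V : 'M[R]_n)
    (a b : 'rV[R]_n) :
  (forall a b : R, 0 < a -> 0 < b -> a != b -> phi a + psi a * (b - a) < phi b) ->
  posdefmx X -> eigdecmx X U a -> eigdecmx X V b ->
  \sum_i phi (a 0 i) = \sum_i phi (b 0 i).
Proof.
move=> tan pX.
suff le U' V' a' b' : eigdecmx X U' a' -> eigdecmx X V' b' ->
    \sum_i phi (a' 0 i) <= \sum_i phi (b' 0 i).
  by move=> Xa Xb; apply/eqP; rewrite eq_le (le _ _ _ _ Xa Xb) (le _ _ _ _ Xb Xa).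
move=> Xa Xb; have := klein_le tan Xa Xb pX pX.
rewrite [X in _ + X]big1 ?addr0 // => i _.
by rewrite (eigdec_qf_col Xa) subrr mulr0.
Qed.

Lemma posdef_unitmx (R : realFieldType) n (X : 'M[R]_n) : posdefmx X -> X \in unitmx.
Proof.
move=> [_ pX]; rewrite unitmxE unitfE; apply/det0P => -[v v0 vX].
have := pX v^T; rewrite trmx_eq0 => /(_ v0).
by rewrite /qf trmxK vX mul0mx mxE ltxx.
Qed.

Lemma posdef_congr (R : realFieldType) n (X L : 'M[R]_n) :
  L \in unitmx -> posdefmx X -> posdefmx (L *m X *m L^T).
Proof.
move=> uL [sX pX]; split; first by rewrite !trmx_mul trmxK sX mulmxA.
move=> x x0; rewrite -{1}[L]trmxK qf_congr pX //.
apply: contra x0 => /eqP Lx.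
have uLT : L^T \in unitmx by rewrite unitmx_tr.
by rewrite -[x](mulKmx uLT) Lx mulmx0.
Qed.

Definition to_mx p q (M : Mat) : 'M[R]_(p, q) := \matrix_(i, j) M i j.
Definition to_cV p (x : Vec) : 'cV[R]_p := \col_i x i.
Definition of_mx p q (M : 'M[R]_(p, q)) : Mat := fun i j =>
  if insub i is Some i' then if insub j is Some j' then M i' j' else 0 else 0.
Definition of_cV p (x : 'cV[R]_p) : Vec := fun i =>
  if insub i is Some i' then x i' 0 else 0.

Lemma of_mxK p q : cancel (@of_mx p q) (to_mx p q).
Proof. by move=> M; apply/matrixP => i j; rewrite mxE /of_mx !valK. Qed.

Lemma of_mxE p q (M : 'M[R]_(p, q)) i j (ip : (i < p)%N) (jq : (j < q)%N) :
  of_mx M i j = M (Ordinal ip) (Ordinal jq).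
Proof. by rewrite -[in RHS](of_mxK M) mxE. Qed.

Lemma of_cVK p : cancel (@of_cV p) (to_cV p).
Proof. by move=> x; apply/colP => i; rewrite mxE /of_cV valK. Qed.

Lemma rsumE k f : rsum k f = \sum_(i < k) f i.
Proof. by elim: k => [|k IH]; rewrite ?big_ord0 // big_ord_recr /= IH. Qed.

Lemma meqP p q A B : meq p q A B <-> to_mx p q A = to_mx p q B.
Proof.
split=> [h|/matrixP h i j /ssrnat.ltP ip /ssrnat.ltP jq].
  by apply/matrixP => i j; rewrite !mxE; apply: h; apply/ssrnat.ltP.
by have := h (Ordinal ip) (Ordinal jq); rewrite !mxE.
Qed.

Lemma mx_mmul p k q A B : to_mx p q (mmul k A B) = to_mx p k A *m to_mx k q B.
Proof.
by apply/matrixP => i j; rewrite !mxE /mmul rsumE; apply: eq_bigr => l _; rewrite !mxE.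
Qed.

Lemma mx_mtr p q A : to_mx p q (mtr A) = (to_mx q p A)^T.
Proof. by apply/matrixP => i j; rewrite !mxE. Qed.

Lemma mx_madd p q A B : to_mx p q (madd A B) = to_mx p q A + to_mx p q B.
Proof. by apply/matrixP => i j; rewrite !mxE. Qed.

Lemma mx_msub p q A B : to_mx p q (msub A B) = to_mx p q A - to_mx p q B.
Proof. by apply/matrixP => i j; rewrite !mxE. Qed.

Lemma mx_mscale p q c A : to_mx p q (mscale c A) = c *: to_mx p q A.
Proof. by apply/matrixP => i j; rewrite !mxE. Qed.

Lemma mx_mid p : to_mx p p mid = 1%:M.
Proof.
apply/matrixP => i j; rewrite !mxE /mid -val_eqE /=.
by have [->|/eqP/Nat.eqb_neq ->] := eqVneq (i : nat) j; rewrite ?Nat.eqb_refl.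
Qed.

Lemma mx_mzero p q : to_mx p q mzero = 0.
Proof. by apply/matrixP => i j; rewrite !mxE. Qed.

Lemma mx_mdiag p d : to_mx p p (mdiag d) = diag_mx (\row_i d i).
Proof.
apply/matrixP => i j; rewrite !mxE /mdiag -val_eqE /=.
by have [->|/eqP/Nat.eqb_neq ->] := eqVneq (i : nat) j; rewrite ?Nat.eqb_refl.
Qed.

Lemma mx_mpow p A k : to_mx p.+1 p.+1 (mpow p.+1 A k) = to_mx p.+1 p.+1 A ^+ k.
Proof. by elim: k => [|k IH]; rewrite /= ?mx_mid // mx_mmul IH exprS. Qed.

Lemma traceE p A : trace p A = \tr (to_mx p p A).
Proof. by rewrite /trace rsumE; apply: eq_bigr => i _; rewrite mxE. Qed.

Lemma cv_mvec p k A x : to_cV p (mvec k A x) = to_mx p k A *m to_cV k x.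
Proof.
by apply/colP => i; rewrite !mxE /mvec rsumE; apply: eq_bigr => j _; rewrite !mxE.
Qed.

Lemma vnonzeroP k x : vnonzero k x <-> to_cV k x != 0.
Proof.
split=> [[i [/ssrnat.ltP ik xi]]|].
  by apply/eqP => /colP/(_ (Ordinal ik)); rewrite !mxE.
move=> x0; apply: contrapT => h; move/eqP: x0; apply; apply/colP => i.
rewrite !mxE; apply: contrapT => xi; apply: h.
by exists i; split => //; apply/ssrnat.ltP.
Qed.

Lemma qf_mx p A x :
  rsum p (fun i => x i * mvec p A x i)%R = qf (to_mx p p A) (to_cV p x).
Proof.
rewrite rsumE /qf -mulmxA -cv_mvec mxE; apply: eq_bigr => i _.
by rewrite !mxE.
Qed.

Lemma posdefP p A : posdef p A <-> posdefmx (to_mx p p A).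
Proof.
split=> [[/meqP sA pA]|[sA pA]]; split.
- by rewrite -mx_mtr.
- move=> x x0; rewrite -[x]of_cVK -qf_mx; apply/RltP/pA/vnonzeroP.
  by rewrite of_cVK.
- by apply/meqP; rewrite mx_mtr.
- by move=> x /vnonzeroP x0; rewrite qf_mx; apply/RltP/pA.
Qed.

Lemma mx_minv p A : to_mx p p A \in unitmx ->
  to_mx p p (minv p A) = invmx (to_mx p p A).
Proof.
move=> uA; have : is_inv p A (minv p A).
  apply: epsilon_spec; exists (of_mx (invmx (to_mx p p A))).
  by split; apply/meqP; rewrite mx_mmul of_mxK mx_mid ?mulmxV ?mulVmx.
case=> /meqP; rewrite mx_mmul mx_mid => h _.
by rewrite -[LHS](mulKmx uA) h mulmx1.
Qed.

(** The spectral theorem guarantees that the [epsilon] in [matfun] picks a genuine decomposition;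
    cyclicity of the trace then removes the orthogonal factors. *)
Lemma matfun_eigdec p M : (to_mx p p M)^T = to_mx p p M ->
  exists U d, eigdecmx (to_mx p p M) U d /\
    forall f, trace p (matfun p f M) = \sum_i f (d 0 i).
Proof.
move=> sM; have ex : exists e, is_eigdec p M e.
  have [U [d [UU Md]]] := symmetric_eigdec sM.
  exists (of_mx U, of_cV d^T); split; apply/meqP => /=.
    by rewrite mx_mmul mx_mtr of_mxK mx_mid.
  rewrite !mx_mmul mx_mtr mx_mdiag of_mxK Md; congr (_ *m diag_mx _ *m _).
  by apply/rowP => i; rewrite !mxE /of_cV valK mxE.
rewrite /matfun; have := epsilon_spec (inhabits (mzero, fun _ : nat => 0%R)) _ ex.
move: (epsilon _ _) => -[U d] [/meqP + /meqP] /=.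
rewrite !mx_mmul !(mx_mtr _ _ U) mx_mid mx_mdiag => UU ME.
exists (to_mx p p U), (\row_i d i); split => // f.
rewrite traceE !mx_mmul mx_mtr mx_mdiag mxtrace_mulC mulmxA UU mul1mx.
by rewrite mxtrace_diag; apply: eq_bigr => i _; rewrite !mxE.
Qed.

Lemma chol_spec p Q : posdefmx (to_mx p p Q) ->
  to_mx p p (chol p Q) *m (to_mx p p (chol p Q))^T = to_mx p p Q.
Proof.
move=> /posdef_cholesky [L [Lt Ld LL]].
have : is_cholesky p Q (chol p Q).
  apply: epsilon_spec; exists (of_mx L); split; [|split].
  - move=> i j /ssrnat.ltP ij /ssrnat.ltP jp; have ip := ltn_trans ij jp.
    by rewrite (of_mxE L ip jp) Lt.
  - move=> i /ssrnat.ltP ip; apply/RltP.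
    by rewrite (of_mxE L ip ip).
  - by apply/meqP; rewrite mx_mmul mx_mtr of_mxK.
by case=> _ [_ /meqP]; rewrite mx_mmul mx_mtr.
Qed.

Lemma ln_prod (I : finType) (f : I -> R) : (forall i, 0 < f i) ->
  ln (\prod_i f i) = \sum_i ln (f i).
Proof.
move=> f0; suff [_ ->] : 0 < \prod_i f i /\ ln (\prod_i f i) = \sum_i ln (f i) by [].
elim/big_ind2: _ => [|x s y t [x0 <-] [y0 <-]|i _] //.
  by split; [exact: ltr01 | exact: ln_1].
by split; [exact: mulr_gt0 | apply: ln_mult; apply/RltP].
Qed.

Lemma posdef_det_gt0 n (X : 'M[R]_n) : posdefmx X -> 0 < \det X.
Proof.
move=> pX; have [U [d Xd]] := symmetric_eigdec (proj1 pX).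
by rewrite (eigdec_det Xd) prodr_gt0 // => i _; apply: (eigdec_gt0 Xd).
Qed.

(** Reduces the Burg case to determinants, which are multiplicative under whitening although
    logarithms of matrices are not additive. *)
Lemma sum_ln_eigdec n (X U : 'M[R]_n) d : posdefmx X -> eigdecmx X U d ->
  \sum_i ln (d 0 i) = ln (\det X).
Proof.
by move=> pX Xd; rewrite (eigdec_det Xd) ln_prod // => i; apply: (eigdec_gt0 Xd).
Qed.

Definition DT_shift (n : nat) (tau : R) : R :=
  if Req_dec_T tau 0 then - INR n else INR n / tau.

(** * Whitening by the Cholesky factor *)

Section Whitening.
Variables (n : nat) (C : Mat).
Hypothesis pC : posdefmx (to_mx n n C).
Let L := to_mx n n (chol n C).

Lemma chol_unitmx : L \in unitmx.
Proof.
have := posdef_unitmx pC; rewrite -(chol_spec pC) unitmx_mul.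
by case/andP.
Qed.

Definition whiten (S : 'M[R]_n) : 'M[R]_n := invmx L *m S *m (invmx L)^T.

Lemma whitenK : cancel whiten (fun X => L *m X *m L^T).
Proof.
move=> S; rewrite /whiten !mulmxA mulmxV ?chol_unitmx // mul1mx -mulmxA.
by rewrite -trmx_mul mulmxV ?chol_unitmx // trmx1 mulmx1.
Qed.

Lemma unwhitenK : cancel (fun X => L *m X *m L^T) whiten.
Proof.
move=> X; rewrite /whiten !mulmxA mulVmx ?chol_unitmx // mul1mx -mulmxA.
by rewrite -trmx_mul mulVmx ?chol_unitmx // trmx1 mulmx1.
Qed.

Lemma whiten_posdef S : posdefmx S -> posdefmx (whiten S).
Proof. by apply: posdef_congr; rewrite unitmx_inv chol_unitmx. Qed.

Lemma unwhiten_posdef X : posdefmx X -> posdefmx (L *m X *m L^T).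
Proof. exact/posdef_congr/chol_unitmx. Qed.

Lemma mxtrace_whiten S : \tr (S *m invmx (to_mx n n C)) = \tr (whiten S).
Proof.
have uLT : L^T \in unitmx by rewrite unitmx_tr chol_unitmx.
have -> : invmx (to_mx n n C) = (invmx L)^T *m invmx L.
  have CI : to_mx n n C *m ((invmx L)^T *m invmx L) = 1%:M.
    rewrite -(chol_spec pC) -/L -mulmxA (mulmxA L^T) -trmx_mul mulVmx ?chol_unitmx //.
    by rewrite trmx1 mul1mx mulmxV ?chol_unitmx.
  by rewrite -[RHS](mulKmx (posdef_unitmx pC)) CI mulmx1.
by rewrite mulmxA mxtrace_mulC mulmxA.
Qed.

Lemma det_whiten S : \det (whiten S) * \det (to_mx n n C) = \det S.
Proof.
rewrite -{2}[S]whitenK !det_mulmx -(chol_spec pC) det_mulmx.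
by rewrite -/L; ring.
Qed.

Lemma mx_DT_argument S :
  to_mx n n (mmul n (mmul n (minv n (chol n C)) S) (mtr (minv n (chol n C)))) =
  whiten (to_mx n n S).
Proof.
by rewrite !mx_mmul (mx_mtr _ _ (minv n (chol n C))) mx_minv // chol_unitmx.
Qed.

(** For tau <> 0 the whitened matrix is itself the argument of [matfun]. For tau = 0 the logarithms
    of C and S are decomposed separately and meet through ln det. *)
Lemma DT_spectral tau S : posdefmx (to_mx n n S) ->
  exists U d, eigdecmx (whiten (to_mx n n S)) U d /\
    DT n tau S C = \sum_i divergence_fun tau (d 0 i) + DT_shift n tau.
Proof.
move=> pS; have pX := whiten_posdef pS.
rewrite /DT /DT_shift /divergence_fun; case: Req_dec_T => tau0.
  have [U [d Xd]] := symmetric_eigdec (proj1 pX); exists U, d; split => //.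
  have [U1 [d1 [Cd trC]]] := matfun_eigdec (proj1 pC).
  have [U2 [d2 [Sd trS]]] := matfun_eigdec (proj1 pS).
  rewrite traceE mx_madd mx_msub mx_mmul mx_minv ?posdef_unitmx //.
  rewrite !raddfD /= raddfN /= -!traceE trC trS mxtrace_whiten (eigdec_mxtrace Xd).
  rewrite RminusE; congr (_ - _); rewrite sumrB addrC; congr (_ + _).
  rewrite (sum_ln_eigdec pC Cd) (sum_ln_eigdec pS Sd) (sum_ln_eigdec pX Xd).
  rewrite -(det_whiten (to_mx n n S)) [ln (_ * _)]ln_mult; last first.
  - exact/RltP/posdef_det_gt0.
  - exact/RltP/posdef_det_gt0.
  by rewrite RplusE opprD addrCA subrr addr0.
have [] := @matfun_eigdec n
  (mmul n (mmul n (minv n (chol n C)) S) (mtr (minv n (chol n C)))).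
  by rewrite mx_DT_argument; apply pX.
rewrite mx_DT_argument => U [d [Xd trf]]; exists U, d; split => //.
rewrite traceE mx_msub !mx_mscale mx_mmul mx_minv ?posdef_unitmx //.
rewrite RplusE; congr (_ + _).
rewrite raddfB /= !linearZ /= -traceE trf mxtrace_whiten (eigdec_mxtrace Xd).
by rewrite !mulr_sumr -sumrB.
Qed.

End Whitening.

(** * The constraint and a feasible point *)

Lemma mx_Vop n m A B S : to_mx n n (Vop n m A B S) =
  to_mx n n (PiBperp n m B) *m
    (to_mx n n S - to_mx n n A *m to_mx n n S *m (to_mx n n A)^T)
    *m to_mx n n (PiBperp n m B).
Proof. by rewrite /Vop !mx_mmul mx_msub !mx_mmul (mx_mtr _ _ A). Qed.

(** Full column rank makes B^T B positive definite, so [minv] is its true inverse. Hence the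
    projection annihilates the right-hand side B B^T of the Lyapunov equation. *)
Lemma PiBperp_mul n m B : full_col_rank n m B ->
  to_mx n n (PiBperp n m B) *m to_mx n m B = 0.
Proof.
move=> rkB; set b := to_mx n m B.
have pB : posdefmx (b^T *m b).
  split; first by rewrite trmx_mul trmxK.
  move=> x x0; rewrite -[b^T]mulmx1 qf_congr qf1_gt0 //.
  have /vnonzeroP := rkB (of_cV x) ltac:(by apply/vnonzeroP; rewrite of_cVK).
  by rewrite cv_mvec of_cVK.
have bb : to_mx m m (mmul n (mtr B) B) = b^T *m b by rewrite mx_mmul (mx_mtr _ _ B).
rewrite /PiBperp mx_msub mx_mid !mx_mmul (mx_mtr _ _ B) mx_minv bb ?posdef_unitmx //.
by rewrite -/b mulmxBl mul1mx -!mulmxA mulVmx ?posdef_unitmx // mulmx1 subrr.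
Qed.

Lemma schur_stable_mx n A : schur_stable n A ->
  forall a b (x y : 'cV[R]_n), x != 0 \/ y != 0 ->
    to_mx n n A *m x = a *: x - b *: y -> to_mx n n A *m y = b *: x + a *: y ->
    a * a + b * b < 1.
Proof.
move=> st a b x y xy Ax Ay; apply/RltP; apply: (st a b (of_cV x) (of_cV y)).
- by case: xy => h; [left | right]; apply/vnonzeroP; rewrite of_cVK.
- move=> i /ssrnat.ltP iN.
  have : to_cV n (mvec n A (of_cV x)) = a *: to_cV n (of_cV x) - b *: to_cV n (of_cV y).
    by rewrite cv_mvec !of_cVK.
  by move/colP/(_ (Ordinal iN)); rewrite !mxE.
- move=> i /ssrnat.ltP iN.
  have : to_cV n (mvec n A (of_cV y)) = b *: to_cV n (of_cV x) + a *: to_cV n (of_cV y).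
    by rewrite cv_mvec !of_cVK.
  by move/colP/(_ (Ordinal iN)); rewrite !mxE.
Qed.

Lemma reachable_mx n m A B : reachable n.+1 m A B ->
  forall w : 'cV[R]_n.+1, w != 0 ->
  exists2 k, (k < n.+1)%N & w^T *m to_mx n.+1 n.+1 A ^+ k *m to_mx n.+1 m B != 0.
Proof.
move=> re w w0.
have [|k [j [/ssrnat.ltP kn [/ssrnat.ltP jm nz]]]] := re (of_cV w).
  by apply/vnonzeroP; rewrite of_cVK.
exists k => //; apply/eqP => /matrixP /(_ 0 (Ordinal jm)).
rewrite -mulmxA -mx_mpow -mx_mmul mxE [RHS]mxE => z; apply: nz; rewrite rsumE -[RHS]z.
by apply: eq_bigr => i _; rewrite -{2}(of_cVK w) !mxE.
Qed.

Lemma feasible_point n m A B : schur_stable n.+1 A -> full_col_rank n.+1 m B ->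
  reachable n.+1 m A B ->
  exists2 Q, posdefmx Q &
    to_mx n.+1 n.+1 (PiBperp n.+1 m B) *m
    (Q - to_mx n.+1 n.+1 A *m Q *m (to_mx n.+1 n.+1 A)^T) *m
    to_mx n.+1 n.+1 (PiBperp n.+1 m B) = 0.
Proof.
move=> st rk re.
have [Q pQ QE] :=
  lyapunov_posdef (stable_mxpow_small (schur_stable_mx st)) (reachable_mx re).
by exists Q => //; rewrite QE !mulmxA PiBperp_mul // !mul0mx.
Qed.

Lemma divergence_fun_tangentP (tau : R) : Rle 0 tau /\ Rlt tau 1 ->
  forall a b : R, 0 < a -> 0 < b -> a != b ->
  divergence_fun tau a + divergence_deriv tau a * (b - a) < divergence_fun tau b.
Proof.
move=> ht a b /RltP a0 /RltP b0 /eqP ab.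
exact/RltP/divergence_fun_tangent.
Qed.

Theorem DT_minimizer (n m : nat) (A B C : Mat) (tau : R) :
  (m < n)%coq_nat -> schur_stable n A -> full_col_rank n m B -> reachable n m A B ->
  posdef n C -> Rle 0 tau /\ Rlt tau 1 ->
  let feasible := fun S => posdef n S /\ meq n n (Vop n m A B S) mzero in
  exists S, feasible S /\
    (forall S', feasible S' -> Rle (DT n tau S C) (DT n tau S' C)) /\
    (forall S', feasible S' ->
       (forall S'', feasible S'' -> Rle (DT n tau S' C) (DT n tau S'' C)) ->
       meq n n S' S).
Proof.
case: n => [|n] mn st rk re /posdefP pC ht feasible; first by move/ssrnat.ltP: mn.
set L := to_mx n.+1 n.+1 (chol n.+1 C); set P := to_mx n.+1 n.+1 (PiBperp n.+1 m B).
set a := to_mx n.+1 n.+1 A.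
(* The constraint [Vop] in whitened coordinates. *)
pose W X := P *m lyapunov a (L *m X *m L^T) *m P.
have W_linear : linear W.
  move=> c X Y; rewrite /W.
  have -> : L *m (c *: X + Y) *m L^T = c *: (L *m X *m L^T) + L *m Y *m L^T.
    by rewrite mulmxDr mulmxDl -scalemxAr -scalemxAl.
  rewrite lyapunov_is_linear; move: (lyapunov a _) (lyapunov a _) => Z1 Z2.
  by rewrite mulmxDr mulmxDl -scalemxAr -scalemxAl.
pose phi := divergence_fun tau.
pose obj (X : 'M[R]_n.+1) := trace n.+1 (matfun n.+1 phi (of_mx X)).
have objE X : posdefmx X -> exists U d, eigdecmx X U d /\ obj X = \sum_i phi (d 0 i).
  move=> pX; have [] := @matfun_eigdec n.+1 (of_mx X); rewrite of_mxK ?(proj1 pX) //.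
  by move=> U [d [Xd h]]; exists U, d; split; last exact: h.
have [Q pQ WQ] := feasible_point st rk re.
have tan := divergence_fun_tangentP ht.
pose wh := @whiten n.+1 C.
have whK := whitenK pC.
have feasP (S : Mat) : feasible S <-> feasible_mx W (wh (to_mx n.+1 n.+1 S)).
  rewrite /feasible /feasible_mx /W whK; split=> [[/posdefP pS /meqP VS]|[pS VS]].
    by split; [exact: whiten_posdef | move: VS; rewrite mx_Vop mx_mzero].
  split; last by apply/meqP; rewrite mx_Vop mx_mzero.
  by apply/posdefP; have := unwhiten_posdef pC pS; rewrite whK.
have DTE (S : Mat) : feasible S ->
    DT n.+1 tau S C = obj (wh (to_mx n.+1 n.+1 S)) + DT_shift n.+1 tau.
  move=> [/posdefP pS _]; have [U [d [Xd ->]]] := DT_spectral pC tau pS.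
  congr (_ + _); have pX := whiten_posdef pC pS.
  have [V [e [Xe ->]]] := objE _ pX.
  exact: eigdec_sum_unique tan pX Xd Xe.
have ub x : 0 < x -> divergence_deriv tau x <= / (1 - tau).
  by move=> _; apply/RleP/divergence_deriv_ub.
have [||||X [fX minX uniX]] := @spectral_minimizer _ phi (divergence_deriv tau)
    (/ (1 - tau))%R tan _ ub _ _ n.+1 W obj (wh Q) W_linear objE.
- exists 2%R; first by apply/RltP; apply: Rlt_0_2.
  exact/RltP/divergence_deriv_2.
- by move=> x /RltP x0; apply/RleP/divergence_deriv_mul_lb.
- move=> M; have [e [e0 h]] := divergence_deriv_ninfty tau M ht.
  exists e; first exact/RltP.
  by move=> x /RltP x0 /RleP xe; apply/RltP/h.
- by split; [exact: whiten_posdef | rewrite /W whK].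
pose S := of_mx (L *m X *m L^T).
have SX : wh (to_mx n.+1 n.+1 S) = X by rewrite /S of_mxK /wh unwhitenK.
have fS : feasible S by apply/feasP; rewrite SX.
exists S; split => //; split=> S' fS'.
  by apply/RleP; rewrite !DTE // SX lerD2r minX //; apply/feasP.
(* Another minimizer does at least as well as S; uniqueness of X carries back because whitening is
   invertible. *)
move=> /(_ S fS) /RleP; rewrite !DTE // SX lerD2r => le.
apply/meqP; rewrite /S of_mxK -(uniX _ _ le) ?whK //; exact/feasP.
Qed.

End SpectralDivergence.

Theorem theorem2 (n m : nat) (A B SigC : Mat) (nu : nat) :
  (m < n)%nat ->
  schur_stable n A ->
  full_col_rank n m B ->
  reachable n m A B ->
  posdef n SigC ->
  (1 <= nu)%nat ->
  let tau := 1 - / INR nu in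
  let feasible := fun S => posdef n S /\ meq n n (Vop n m A B S) mzero in
  exists S, feasible S /\
    (forall S', feasible S' -> DT n tau S SigC <= DT n tau S' SigC) /\
    (forall S', feasible S' ->
       (forall S'', feasible S'' -> DT n tau S' SigC <= DT n tau S'' SigC) ->
       meq n n S' S).
Proof.
intros mn stA rkB reAB pC nu1.
assert (Hnu : 1 <= INR nu) by (apply (le_INR 1 nu nu1)).
apply SpectralDivergence.DT_minimizer; try assumption.
(* 1/nu lies in ]0, 1], so tau lies in [0, 1[, and nu = 1 is the Burg case. *)
assert (0 < / INR nu) by (apply Rinv_0_lt_compat; lra).
assert (/ INR nu <= 1) by (rewrite <- Rinv_1; apply Rinv_le_contravar; lra).
lra.
Qed.
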